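(* For each $n\in\mathbb N$, let $X_{n1}$ be a hanging set on $J_1$ which is permeable with respect to a hutch $D_{n1}$, and $X_{n2}$ a hanging set on $J_{-1}$ which is permeable with respect to a hutch $D_{n2}$. Suppose $\lim_{n\to\infty}\mathrm{diam}(D_{n1})=\lim_{n\to\infty}\mathrm{diam}(D_{n2})=0$ and the discs in $\{D_{n1},D_{n2}:n\in\mathbb N\}$ are pairwise disjoint. Write $X_{\mathbb N}=\bigcup\{X_{n1}\cup X_{n2}:n\in\mathbb N\}$. Let $\mathbb N',\mathbb N''\subset\mathbb N$ be such that for each $n\in\mathbb N'$ there are a floating set $Y_{n1}$ and a cable $L_{n1}$ from $Y_{n1}$ to $J_1$ with $X_{n1}=Y_{n1}\cup L_{n1}$, and for each $n\in\mathbb N''$ there are a floating set $Y_{n2}$ and a cable $L_{n2}$ from $Y_{n2}$ to $J_{-1}$ with $X_{n2}=Y_{n2}\cup L_{n2}$. Let $\{W_n:n\in\mathbb N\}$ be a family of pairwise disjoint countable sets in $(-1,1)^2-X_{\mathbb N}$, each dense in $J^2$. Then there exists a homeomorphism $\psi:J^2\to J^2$ such that: (1) for $n\in\mathbb N-\mathbb N'$ and $w\in W_n$, $\omega_\psi(w)=X_{n1}$; (2) for $n\in\mathbb N'$ and $w\in W_n$, $\omega_\psi(w)=Y_{n1}$; (3) for $n\in\mathbb N-\mathbb N''$ and $w\in W_n$, $\alpha_\psi(w)=X_{n2}$; (4) for $n\in\mathbb N''$ and $w\in W_n$, $\alpha_\psi(w)=Y_{n2}$.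
   Context: $J=[-1,1]$, $J_s=J\times\{s\}$, $\stackrel{\circ}{J_s}=(-1,1)\times\{s\}$ for $s\in\{-1,1\}$, $\partial J^2$ the boundary of the square $J^2$. For an arc $I$, $\stackrel{\circ}{I}$ (also $\mathrm{Int}\,I$) is $I$ minus its endpoints; for a disc $D$, $\stackrel{\circ}{D}$ is its interior, $\partial D$ its boundary circle. A hanging set on $J_s$ is a nonempty compact connected $X\subset J^2$ with $X\cap\partial J^2$ a nonempty connected subset of $\stackrel{\circ}{J_s}$. A floating set is a nonempty compact connected $Y\subset J^2$ with $Y\cap\partial J^2=\emptyset$; a cable from $Y$ to $J_s$ is an arc $L\subset J^2$ with one endpoint in $\stackrel{\circ}{J_s}$, the other in $Y$, and $\stackrel{\circ}{L}\cap(\partial J^2\cup Y)=\emptyset$. A hutch of a hanging set $X$ on $J_s$ is a disc $D\subset J^2$ which is a hanging set on $J_s$ with $D\cap\partial J^2$ an arc, such that $X\cap J_s\subset\mathrm{Int}(D\cap J_s)$ and $X-J_s\subset\stackrel{\circ}{D}$. $X$ is permeable with respect to the hutch $D$ if, with $A=D\cap J_s$, there exists a continuous $\eta:D\to D$ such that (C.1) $\eta|(\partial D-\stackrel{\circ}{A})=\mathrm{id}$, $\eta(A)=A\cup X$, and there is an arc $A'\subset\stackrel{\circ}{A}$ with $X\cap J_s\subset\mathrm{Int}\,A'$, $\eta(A-A')=A-(X\cap J_s)$, $\eta(A')=X$, $\eta|(A-A')$ injective; (C.2) $\eta(\stackrel{\circ}{D})=\stackrel{\circ}{D}-X$ and $\eta|\stackrel{\circ}{D}$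 injective. $\omega_\psi(w)$ and $\alpha_\psi(w)=\omega_{\psi^{-1}}(w)$ are the $\omega$- and $\alpha$-limit sets of $w$ under $\psi$. *)

(* Defs.v *)
(* Points of the plane are R * R
   (product topology = Euclidean topology). *)
From HB Require Import structures.
From mathcomp Require Import all_boot all_order all_algebra.
From mathcomp Require Import all_classical all_reals all_analysis.
Set Implicit Arguments. Unset Strict Implicit. Unset Printing Implicit Defensive.
Import Order.TTheory GRing.Theory Num.Theory numFieldNormedType.Exports.
Local Open Scope classical_set_scope.
Local Open Scope ring_scope.

Section Defs.
Variable R : realType.
Definition pt := (R * R)%type.

Definition sq : set pt := [set p | -1 <= p.1 <= 1 /\ -1 <= p.2 <= 1].
Definition osq : set pt := [set p | -1 < p.1 < 1 /\ -1 < p.2 < 1].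
Definition bdsq : set pt := sq `\` osq.
Definition Js (s : R) : set pt := [set p | -1 <= p.1 <= 1 /\ p.2 = s].
Definition Jso (s : R) : set pt := [set p | -1 < p.1 < 1 /\ p.2 = s].

Definition homeo_pair {T U : topologicalType} (A : set T) (B : set U)
    (f : T -> U) (g : U -> T) : Prop :=
  {within A, continuous f} /\ {within B, continuous g} /\
  (forall x, A x -> B (f x)) /\ (forall y, B y -> A (g y)) /\
  (forall x, A x -> g (f x) = x) /\ (forall y, B y -> f (g y) = y).

Definition unit_interval : set R := [set t | 0 <= t <= 1].
Definition unit_disc : set pt := [set p | p.1 ^+ 2 + p.2 ^+ 2 <= 1].

Definition arc_ends (I : set pt) (a b : pt) : Prop :=
  exists h : R -> pt, exists g : pt -> R,
    homeo_pair unit_interval I h g /\ h 0 = a /\ h 1 = b.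
Definition is_arc (I : set pt) : Prop := exists a b, arc_ends I a b.
Definition arc_int (I : set pt) : set pt :=
  [set x | I x /\ forall a b, arc_ends I a b -> x <> a /\ x <> b].

Definition is_disc (D : set pt) : Prop :=
  exists h : pt -> pt, exists g : pt -> pt, homeo_pair unit_disc D h g.
Definition disc_int (D : set pt) : set pt := interior D.
Definition disc_bd (D : set pt) : set pt := D `\` interior D.

Definition hanging (s : R) (X : set pt) : Prop :=
  X !=set0 /\ compact X /\ connected X /\ X `<=` sq /\
  (X `&` bdsq) !=set0 /\ connected (X `&` bdsq) /\ X `&` bdsq `<=` Jso s.

Definition floating (Y : set pt) : Prop :=
  Y !=set0 /\ compact Y /\ connected Y /\ Y `<=` sq /\ Y `&` bdsq = set0.

Definition cable (s : R) (Y L : set pt) : Prop :=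
  L `<=` sq /\ exists a b, arc_ends L a b /\ Jso s a /\ Y b /\
    (L `\` [set a; b]) `&` (bdsq `|` Y) = set0.

Definition hutch (s : R) (X D : set pt) : Prop :=
  is_disc D /\ D `<=` sq /\ hanging s D /\ is_arc (D `&` bdsq) /\
  X `&` Js s `<=` arc_int (D `&` Js s) /\
  X `\` Js s `<=` disc_int D.

Definition permeable (s : R) (X D : set pt) : Prop :=
  let A := D `&` Js s in
  exists eta : pt -> pt,
    {within D, continuous eta} /\ eta @` D `<=` D /\
    (forall x, (disc_bd D `\` arc_int A) x -> eta x = x) /\
    eta @` A = A `|` X /\
    (exists A' : set pt, is_arc A' /\ A' `<=` arc_int A /\
       X `&` Js s `<=` arc_int A' /\
       eta @` (A `\` A') = A `\` (X `&` Js s) /\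
       eta @` A' = X /\
       {in A `\` A' &, injective eta}) /\
    eta @` disc_int D = disc_int D `\` X /\
    {in disc_int D &, injective eta}.

Definition dist (p q : pt) : R :=
  Num.sqrt ((p.1 - q.1) ^+ 2 + (p.2 - q.2) ^+ 2).
Definition diam (D : set pt) : R :=
  sup [set d | exists p q, D p /\ D q /\ d = dist p q].

Definition omega_lim (f : pt -> pt) (w : pt) : set pt :=
  [set y | forall U, nbhs y U -> forall N : nat, exists n, (N <= n)%N /\ U (iter n f w)].
End Defs.

(* Main.v *)
(** Let [phi] be a homeomorphism of the square that fixes its top and bottom
    sides pointwise and moves the given countable set of points so that the point
    attached to [n] has omega-limit a segment [B_n1] of the top side and
    alpha-limit a segment [B_n2] of the bottom side.  Let [xi] be the permeation
    maps on the hutches and the identity elsewhere: [xi] is injective on the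
    open square and misses exactly the hanging sets there, so [phi] descends
    through [xi] to the required homeomorphism, and limit sets are pushed
    forward by [xi].

    Such a [phi] is written down in coordinates identifying [(-1, 1)] with the line.
    It translates a phase [tau] by 1, the phase being a functional of the two
    coordinates chosen so generic that distinct given points have phases
    distinct modulo 1, and it adds [g tau] to [(1 + |tau|) s], where [s] is the
    horizontal coordinate.  Hence [s] follows the averages of [g] along
    [tau + Z], whatever its initial value, and [g] can be prescribed freely on
    the closed discrete set of the far phases of the given points.

    It remains to choose [B_n1] with [xi B_n1 = Y_n1] when [X_n1] is a floating set
    hung by a cable.  The preimage of [Y_n1] in the side of the hutch has no
    gap: a gap would give a loop through the free end of the cable whose winding
    number around nearby points is even, because the cable joins the loop to
    the side of the square, and odd, because [eta] is injective inside the
    hutch.  The parity of a winding number is expressed by the existence of a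
    continuous square root.  *)
Require Import Defs.
From HB Require Import structures.
From mathcomp Require Import all_boot all_order all_algebra.
From mathcomp Require Import all_classical all_reals all_analysis.
From mathcomp Require Import ring lra.
Import Order.TTheory GRing.Theory Num.Theory numFieldNormedType.Exports.
Local Open Scope classical_set_scope.
Local Open Scope ring_scope.
Set Implicit Arguments.
Unset Strict Implicit.

(** * Continuity relative to a set, and square roots of loops *)

Section ContOn.
Context {T U : topologicalType}.

(** Subspace continuity unfolded into convergence along the filter [within A (nbhs x)], the form to
    which limit rules for sums, products and pairs apply directly. *)
Definition cont_on (A : set T) (f : T -> U) : Prop :=
  forall x, A x -> f @ within A (nbhs x) --> f x.

Lemma cont_onP (A : set T) (f : T -> U) : {within A, continuous f} <-> cont_on A f.
Proof. exact: subspace_continuousP. Qed.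

Lemma cont_onS (A B : set T) (f : T -> U) : A `<=` B -> cont_on B f -> cont_on A f.
Proof.
move=> AB cf x Ax W /(cf x (AB _ Ax)).
by apply: (@filterS _ (nbhs x)) => y h /AB; apply: h.
Qed.

Lemma cont_on_eq (A : set T) (f g : T -> U) :
  (forall x, A x -> f x = g x) -> cont_on A f -> cont_on A g.
Proof.
move=> fg cf x Ax W; rewrite -fg// => /(cf x Ax).
by apply: (@filterS _ (nbhs x)) => y h Ay; rewrite /= -fg//; apply: h.
Qed.

Lemma continuous_cont_on (A : set T) (f : T -> U) : continuous f -> cont_on A f.
Proof. by move=> cf x Ax; apply: cvg_within_filter; apply: cf. Qed.

Lemma cont_onT (f : T -> U) : cont_on setT f -> continuous f.
Proof.
move=> cf x W /(cf x I); apply: (@filterS _ (nbhs x)) => y h; exact: h I.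
Qed.

Lemma cont_on_cst (A : set T) (c : U) : cont_on A (fun=> c).
Proof. by apply: continuous_cont_on => x; apply: cvg_cst. Qed.

Lemma cont_onU (A B : set T) (f : T -> U) : closed A -> closed B ->
  cont_on A f -> cont_on B f -> cont_on (A `|` B) f.
Proof.
move=> cA cB fA fB x ABx W Wx.
have H (C : set T) : closed C -> cont_on C f -> nbhs x (fun y => C y -> W (f y)).
  move=> cC fC; have [Cx|nCx] := pselect (C x); first exact: (fC x Cx).
  have : nbhs x (~` C) by apply: open_nbhs_nbhs; split => //; exact: closed_openC.
  by apply: filterS => y /= nC /nC.
by apply: filterS2 (H A cA fA) (H B cB fB) => y ha hb [/ha|/hb].
Qed.

End ContOn.

Lemma cont_on_id (T : topologicalType) (A : set T) : cont_on A id.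
Proof. by apply: continuous_cont_on => x; apply: cvg_id. Qed.

Lemma cont_on_comp (T U V : topologicalType) (A : set T) (B : set U) (f : T -> U) (g : U -> V) :
  cont_on A f -> cont_on B g -> (forall x, A x -> B (f x)) -> cont_on A (g \o f).
Proof.
move=> cf cg AB x Ax W /(cg _ (AB _ Ax)) h.
have := cf x Ax _ h; apply: (@filterS _ (nbhs x)) => y /= k Ay; apply: k => //; exact: AB.
Qed.

Lemma continuous_comp_cont_on (T U V : topologicalType) (A : set T) (f : T -> U) (g : U -> V) :
  continuous g -> cont_on A f -> cont_on A (g \o f).
Proof.
move=> cg cf; apply: (cont_on_comp (B := setT)) => //.
exact: continuous_cont_on.
Qed.

Lemma cont_on_pair (T U V : topologicalType) (A : set T) (f : T -> U) (g : T -> V) :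
  cont_on A f -> cont_on A g -> cont_on A (fun x => (f x, g x)).
Proof. by move=> cf cg x Ax; apply: cvg_pair; [exact: cf|exact: cg]. Qed.

Lemma cont_on_fst (T U V : topologicalType) (A : set T) (f : T -> U * V) :
  cont_on A f -> cont_on A (fun x => (f x).1).
Proof. move=> cf; apply: (continuous_comp_cont_on (g := fst)) => // x; exact: cvg_fst. Qed.

Lemma cont_on_snd (T U V : topologicalType) (A : set T) (f : T -> U * V) :
  cont_on A f -> cont_on A (fun x => (f x).2).
Proof. move=> cf; apply: (continuous_comp_cont_on (g := snd)) => // x; exact: cvg_snd. Qed.

Section ContOnNormed.
Context {R : realType} {T : topologicalType}.
Implicit Types (A : set T).

Section Nmod.
Context {V : normedModType R}.
Implicit Types (f g : T -> V).

Lemma cont_onD A f g : cont_on A f -> cont_on A g -> cont_on A (fun x => f x + g x).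
Proof. by move=> cf cg x Ax; apply: cvgD; [exact: cf|exact: cg]. Qed.

Lemma cont_onB A f g : cont_on A f -> cont_on A g -> cont_on A (fun x => f x - g x).
Proof. by move=> cf cg x Ax; apply: cvgB; [exact: cf|exact: cg]. Qed.

Lemma cont_onN A f : cont_on A f -> cont_on A (fun x => - f x).
Proof. by move=> cf x Ax; apply: cvgN; exact: cf. Qed.

Lemma cont_on_norm A f : cont_on A f -> cont_on A (fun x => `|f x|).
Proof. by move=> cf x Ax; apply: cvg_norm; exact: cf. Qed.

Lemma cont_onZ A (k : T -> R) f :
  cont_on A k -> cont_on A f -> cont_on A (fun x => k x *: f x).
Proof. by move=> cf cg x Ax; apply: cvgZ; [exact: cf|exact: cg]. Qed.
End Nmod.

Implicit Types (f g : T -> R).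
Lemma cont_onM A f g : cont_on A f -> cont_on A g -> cont_on A (fun x => f x * g x).
Proof. by move=> cf cg x Ax; apply: cvgM; [exact: cf|exact: cg]. Qed.

Lemma cont_onV A f : (forall x, A x -> f x != 0) ->
  cont_on A f -> cont_on A (fun x => (f x)^-1).
Proof. by move=> f0 cf x Ax; apply: cvgV; [exact: f0|exact: cf]. Qed.

Lemma cont_on_sqrt A f : cont_on A f -> cont_on A (fun x => Num.sqrt (f x)).
Proof. by apply: (continuous_comp_cont_on (g := Num.sqrt)); exact: sqrt_continuous. Qed.
End ContOnNormed.

Section Cplx.
Context {R : realType}.

Lemma cont_on_fst_id (B : set (R * R)) : cont_on B fst.
Proof. by apply: (cont_on_fst (f := id)); exact: cont_on_id. Qed.

Lemma cont_on_snd_id (B : set (R * R)) : cont_on B snd.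
Proof. by apply: (cont_on_snd (f := id)); exact: cont_on_id. Qed.

Local Notation P := (R * R)%type.
Definition cmul (p q : P) : P := (p.1 * q.1 - p.2 * q.2, p.1 * q.2 + p.2 * q.1).
Definition cdot (p q : P) : R := p.1 * q.1 + p.2 * q.2.
Definition ccross (p q : P) : R := p.1 * q.2 - p.2 * q.1.

Lemma cont_on_cmul (T : topologicalType) (A : set T) (f g : T -> P) :
  cont_on A f -> cont_on A g -> cont_on A (fun x => cmul (f x) (g x)).
Proof.
move=> cf cg; apply: cont_on_pair.
- by apply: cont_onB; apply: cont_onM; do ?[exact: cont_on_fst|exact: cont_on_snd].
- by apply: cont_onD; apply: cont_onM; do ?[exact: cont_on_fst|exact: cont_on_snd].
Qed.

Lemma cont_on_cdot (T : topologicalType) (A : set T) (f g : T -> P) :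
  cont_on A f -> cont_on A g -> cont_on A (fun x => cdot (f x) (g x)).
Proof.
by move=> cf cg; apply: cont_onD; apply: cont_onM;
  do ?[exact: cont_on_fst|exact: cont_on_snd].
Qed.

Lemma cdot_gt0 (p : P) : p != 0 -> 0 < cdot p p.
Proof.
move=> p0; rewrite lt_def /cdot -!expr2; apply/andP; split; last first.
  by rewrite addr_ge0 ?sqr_ge0.
apply: contra p0; rewrite paddr_eq0 ?sqr_ge0// !sqrf_eq0 => /andP[/eqP a /eqP b].
by rewrite [p]surjective_pairing a b.
Qed.

(* For a loop [g] avoiding 0 this says that its winding number is even. *)
Definition has_sqrt (T : topologicalType) (A : set T) (g : T -> P) : Prop :=
  exists2 s, cont_on A s & forall x, A x -> cmul (s x) (s x) = g x.

(* [h / g] is a positive multiple of [conj g * h], whose real part [cdot g h] is positive, so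
   it has a principal square root. *)
Lemma has_sqrt_close (T : topologicalType) (A : set T) (g h : T -> P) :
  cont_on A g -> cont_on A h -> (forall x, A x -> 0 < cdot (g x) (h x)) ->
  has_sqrt A g -> has_sqrt A h.
Proof.
move=> cg ch gh [s cs sE].
pose a x := cdot (g x) (h x); pose b x := ccross (g x) (h x).
pose n x := Num.sqrt (a x ^+ 2 + b x ^+ 2).
pose d x := Num.sqrt (2 * (a x + n x) * cdot (g x) (g x)).
have ca : cont_on A a by exact: cont_on_cdot.
have cb : cont_on A b.
  by apply: cont_onB; apply: cont_onM; do ?[exact: cont_on_fst|exact: cont_on_snd].
have cn : cont_on A n.
  by apply: cont_on_sqrt; apply: cont_onD; rewrite /GRing.exp/=; apply: cont_onM.
have d20 x : A x -> 0 < 2 * (a x + n x) * cdot (g x) (g x).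
  move=> Ax; apply: mulr_gt0.
    by apply: mulr_gt0 => //; apply: ltr_wpDr; [exact: sqrtr_ge0|exact: gh].
  apply: cdot_gt0; apply/eqP => g0; have := gh _ Ax.
  by rewrite g0 /cdot/= !mul0r addr0 ltxx.
have d0 x : A x -> d x != 0 by move=> Ax; rewrite gt_eqF// sqrtr_gt0; exact: d20.
have cd : cont_on A d.
  apply: cont_on_sqrt; apply: cont_onM; last exact: cont_on_cdot.
  by apply: cont_onM; [exact: cont_on_cst|exact: cont_onD].
exists (fun x => cmul (s x) ((a x + n x) / d x, b x / d x)).
  apply: cont_on_cmul => //; apply: cont_on_pair; apply: cont_onM => //.
  - exact: cont_onD.
  - exact: cont_onV.
  - exact: cont_onV.
move=> x Ax; have := sE _ Ax; have := d0 _ Ax; have := d20 _ Ax.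
have d2 : d x ^+ 2 = 2 * (a x + n x) * cdot (g x) (g x).
  by rewrite sqr_sqrtr// ltW// d20.
have n2 : n x ^+ 2 = a x ^+ 2 + b x ^+ 2.
  by rewrite sqr_sqrtr// addr_ge0// sqr_ge0.
move=> d2p dx0 gE.
have -> : cmul (cmul (s x) ((a x + n x) / d x, b x / d x))
               (cmul (s x) ((a x + n x) / d x, b x / d x)) =
   (((cmul (g x) (a x, b x)).1 * (2 * (a x + n x)) / d x ^+ 2),
    ((cmul (g x) (a x, b x)).2 * (2 * (a x + n x)) / d x ^+ 2)).
  rewrite -gE /cmul/=; congr pair; apply: (mulIf (x := d x ^+ 2)); rewrite ?expf_neq0//;
   rewrite (divfK (expf_neq0 _ _))//; move: n2; set n' := n x; set a' := a x; set b' := b x => n2.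
  - rewrite -[RHS]subr0; apply/eqP; rewrite -subr_eq0; apply/eqP.
    set s1 := (s x).1; set s2 := (s x).2.
    transitivity ((s1^+2 - s2 ^+ 2) * (n' ^+ 2 - (a' ^+ 2 + b' ^+ 2))); last by rewrite n2 subrr mulr0.
    by field.
  - rewrite -[RHS]subr0; apply/eqP; rewrite -subr_eq0; apply/eqP.
    set s1 := (s x).1; set s2 := (s x).2.
    transitivity ((2 * s1 * s2) * (n' ^+ 2 - (a' ^+ 2 + b' ^+ 2))); last by rewrite n2 subrr mulr0.
    by field.
have k0 : 2 * (a x + n x) != 0.
  by apply/eqP => k0; move: d2p; rewrite k0 mul0r ltxx.
have g0 : cdot (g x) (g x) != 0.
  by apply/eqP => g0; move: d2p; rewrite g0 mulr0 ltxx.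
rewrite d2 [h x]surjective_pairing; congr pair;
  apply: (mulIf (mulf_neq0 k0 g0)); rewrite (divfK (mulf_neq0 k0 g0)).
- by rewrite /cmul /a /b /cdot /ccross /=; ring.
- by rewrite /cmul /a /b /cdot /ccross /=; ring.
Qed.

Lemma unit_intervalE : @unit_interval R = `[0, 1]%classic.
Proof. by apply/seteqP; split => t /=; rewrite in_itv. Qed.

Lemma unit_interval_compact : compact (@unit_interval R).
Proof. by rewrite unit_intervalE; exact: segment_compact. Qed.

(** By compactness there is a time step during which no value of [H] turns by a right angle;
    [has_sqrt_close] then carries the square root through finitely many such steps. *)
Lemma has_sqrt_homotopy (T : topologicalType) (K : set T) (H : T * R -> P) :
  compact K -> cont_on (K `*` @unit_interval R) H ->
  (forall z, (K `*` @unit_interval R) z -> H z != 0) ->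
  has_sqrt K (fun x => H (x, 0)) -> has_sqrt K (fun x => H (x, 1)).
Proof.
move=> cK cH H0 s0.
have cKI : compact (K `*` @unit_interval R) by apply: compact_setX => //; exact: unit_interval_compact.
have [e e0 He] : exists2 e : R, 0 < e & forall z, (K `*` @unit_interval R) z ->
    forall t', @unit_interval R t' -> `|t' - z.2| < e -> 0 < cdot (H z) (H (z.1, t')).
  (* [T] has no metric, so the uniform step comes from the near-covering form of compactness rather
     than from a Lebesgue number. *)
  pose Q (e : R) (z : T * R) := (K `*` @unit_interval R) z -> forall t',
    @unit_interval R t' -> `|t' - z.2| < e -> 0 < cdot (H z) (H (z.1, t')).
  have h : \forall e \near (0:R)^'+, (K `*` @unit_interval R) `<=` Q e.
    apply: (iffLR (compact_near_coveringP _) cKI).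
    move=> [x t] /= xt.
    have : nbhs (H (x, t), H (x, t)) [set p : P * P | 0 < cdot p.1 p.2].
      have : open [set p : P * P | 0 < cdot p.1 p.2].
        apply: (@open_comp _ _ (fun p : P * P => cdot p.1 p.2) [set r | 0 < r]).
          move=> p _; apply: cont_onT p; apply: cont_on_cdot.
          + by apply: continuous_cont_on => q; exact: cvg_fst.
          + by apply: continuous_cont_on => q; exact: cvg_snd.
        exact: open_gt.
      by move=> o; apply: open_nbhs_nbhs; split => //=; apply: cdot_gt0; exact: (H0 (x, t)).
    move=> [[U V] /= [HU HV] UV].
    have /= := cH (x, t) xt _ (filterI HU HV).
    move=> [[N B] /= [nN [d /= d0 dB]] NB].
    exists ((N `*` ball t (d / 2)), [set e | e < d / 2]) => /=.
      split; last exact: nbhs_right_lt (divr_gt0 _ _).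
      by exists (N, ball t (d/2)) => //; split => //; exact: nbhsx_ballx (divr_gt0 _ _).
    move=> [[x' t'] e] /= [[Nx' tt'] ed] xt' t'' t''01 t''e.
    have [U1 _] : (U `&` V) (H (x', t')).
      apply: NB => //=; split => //; apply: dB => /=.
      by move: tt'; rewrite /ball/=; move=> h; lra.
    have [_ V1] : (U `&` V) (H (x', t'')).
      apply: NB => //=.
        split => //; apply: dB => /=; move: tt'; rewrite /ball/=.
        have := ler_distD t' t t''; rewrite [`|t' - t''|]distrC => h1 h2; lra.
      by split; [exact: xt'.1|].
    exact: (UV (_, _)).
  have [e [e0 he]] := filter_ex (filterI (nbhs_right_gt (0:R)) h).
  by exists e => // z zK t' t'01 tz; apply: (he z zK zK).
have [n ne] : exists n, (n.+1%:R)^-1 < e.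
  by have [n _ hn] := near_infty_natSinv_lt (PosNum e0); exists n; exact: (hn n (leqnn n)).
have cHt t : @unit_interval R t -> cont_on K (fun x => H (x, t)).
  move=> t01; apply: (cont_on_comp (f := fun x => (x, t)) _ cH) => //.
  by apply: cont_on_pair; [exact: cont_on_id|exact: cont_on_cst].
have k01 k : (k <= n.+1)%N -> @unit_interval R (k%:R / n.+1%:R).
  by move=> kn; rewrite /unit_interval/= divr_ge0//= ler_pdivrMr// mul1r ler_nat.
suff: forall k, (k <= n.+1)%N -> has_sqrt K (fun x => H (x, k%:R / n.+1%:R)).
  by move=> /(_ n.+1 (leqnn _)); rewrite divff.
elim=> [_|k IH kn]; first by rewrite mul0r.
apply: has_sqrt_close (IH (ltnW kn)).
- exact/cHt/k01/ltnW.
- exact/cHt/k01.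
move=> x Kx; apply: (He (x, _)) => /=.
- by split => //=; apply: k01; exact: ltnW.
- exact: k01.
by rewrite -mulrBl -natrB// subSnn mul1r gtr0_norm.
Qed.

End Cplx.

(** * Odd maps on the boundary of the square *)

Section Odd.
Context {R : realType}.
Local Notation P := (R * R)%type.

Lemma has_sqrt_eq (T : topologicalType) (A : set T) (f g : T -> P) :
  (forall x, A x -> f x = g x) -> has_sqrt A f -> has_sqrt A g.
Proof. by move=> fg [s cs sE]; exists s => // x Ax; rewrite -fg// sE. Qed.

(** Half-angle formulas; the sign of [b] decides the sign of the second component. *)
Lemma has_sqrt_cst (T : topologicalType) (A : set T) (c : P) : has_sqrt A (fun=> c).
Proof.
case: c => a b; pose n := Num.sqrt (a ^+ 2 + b ^+ 2).
have n2 : n ^+ 2 = a ^+ 2 + b ^+ 2 by rewrite sqr_sqrtr// addr_ge0// sqr_ge0.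
have n0 : 0 <= n by exact: sqrtr_ge0.
have an : `|a| <= n by rewrite -sqrtr_sqr ler_wsqrtr// lerDl sqr_ge0.
have [an1 an2] : 0 <= (n + a) / 2 /\ 0 <= (n - a) / 2.
  by move: an; rewrite ler_norml => /andP[? ?]; split; apply: divr_ge0 => //; lra.
pose s1 := Num.sqrt ((n + a) / 2); pose s2 := Num.sqrt ((n - a) / 2).
have e1 : s1 ^+ 2 = (n + a) / 2 by rewrite sqr_sqrtr.
have e2 : s2 ^+ 2 = (n - a) / 2 by rewrite sqr_sqrtr.
have e3 : s1 * s2 = `|b| / 2.
  apply/eqP; rewrite -(eqrXn2 (n := 2))// ?divr_ge0// ?mulr_ge0 ?sqrtr_ge0//.
  rewrite exprMn e1 e2 expr_div_n real_normK ?num_real//.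
  by apply/eqP; rewrite -[b ^+ 2](addKr (a ^+ 2)) -n2; field.
exists (fun=> if 0 <= b then (s1, s2) else (s1, - s2)); first exact: cont_on_cst.
move=> x _; rewrite /cmul; case: ifPn => b0 /=; congr pair.
- by rewrite -!expr2 e1 e2; field.
- by rewrite [s2 * s1]mulrC e3 ger0_norm//; field.
- by rewrite mulrNN -!expr2 e1 e2; field.
- by rewrite mulrN mulNr [s2 * s1]mulrC e3 ltr0_norm ?ltNge//; field.
Qed.

Lemma sqE : @sq R = [set z | `|z| <= 1].
Proof.
apply/seteqP; split => -[x y]; rewrite /sq/= prod_normE/= ge_max !ler_norml.
- by move=> [-> ->].
- by move=> /andP[-> ->].
Qed.

Lemma osqE : @osq R = [set z | `|z| < 1].
Proof.
apply/seteqP; split => -[x y]; rewrite /osq/= prod_normE/= gt_max !ltr_norml.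
- by move=> [-> ->].
- by move=> /andP[-> ->].
Qed.

Lemma bdsqE : @bdsq R = [set z | `|z| = 1].
Proof.
rewrite /bdsq sqE osqE; apply/seteqP; split => z /=.
- by move=> [z1 /negP]; rewrite -leNgt => z2; apply: le_anti; rewrite z1.
- by move=> ->; split => //; rewrite ltxx.
Qed.

(** As complex numbers [p = +- i q], so the two vectors are orthogonal and of equal length; they
    cannot be parallel unless both vanish. *)
Lemma cross_neq0 (p q : P) : cmul p p = - cmul q q -> q != 0 -> ccross p q != 0.
Proof.
case: p q => [p1 p2] [q1 q2]; rewrite /cmul /ccross/= => -[h1 h2] q0.
apply: contra q0 => /eqP h3.
have h4 : p1 * p2 = - (q1 * q2) by lra.
have h5 : (q1 * q2) ^+ 2 + (p1 * q2) ^+ 2 = 0.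
  have -> : (p1 * q2) ^+ 2 = (p1 * p2) * (q1 * q2).
    by rewrite expr2 {2}(_ : p1 * q2 = p2 * q1); [ring|lra].
  by rewrite h4; ring.
have /eqP := h5; rewrite paddr_eq0 ?sqr_ge0// !sqrf_eq0 => /andP[/eqP h6 /eqP h7].
have h8 : p2 * q1 = 0 by lra.
have : (q1 ^+ 2 - q2 ^+ 2) ^+ 2 + (p1 * q1) ^+ 2 + (p2 * q2) ^+ 2 = 0.
  transitivity ((q1 ^+ 2 - q2 ^+ 2) * ((q1 * q1 - q2 * q2) + (p1 * p1 - p2 * p2))
     + (p1 * q2) ^+ 2 + (p2 * q1) ^+ 2); first by ring.
  by rewrite h1 h7 h8; ring.
move=> /eqP; rewrite !paddr_eq0 ?addr_ge0 ?sqr_ge0// !sqrf_eq0 => /andP[/andP[/eqP h9 _] _].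
move/eqP: h6; rewrite mulf_eq0 => /orP[] /eqP q10.
- have : q2 ^+ 2 = 0 by rewrite q10 in h9; lra.
  by move=> /eqP; rewrite sqrf_eq0 q10 => /eqP ->.
- have : q1 ^+ 2 = 0 by rewrite q10 in h9; lra.
  by move=> /eqP; rewrite sqrf_eq0 q10 => /eqP ->.
Qed.

(* If [g = s ^ 2] then [s (- z) = +- i s z], so [ccross (s (- z)) (s z)] never vanishes; but it
   changes sign along a path in [bdsq] from a point to its opposite. *)
Lemma odd_no_sqrt (g : P -> P) : (forall z, @bdsq R z -> g (- z) = - g z) ->
  (forall z, @bdsq R z -> g z != 0) -> ~ has_sqrt (@bdsq R) g.
Proof.
move=> godd g0 [s cs sE].
(* A parabola from [(-1, 0)] to [(1, 0)] that misses the origin; dividing by the sup norm puts it on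
   [bdsq]. *)
pose v (t : R) : P := (t, 1 - t ^+ 2).
have v0 t : `|v t| != 0.
  rewrite normr_eq0; apply/eqP => -[t0]; rewrite t0 expr2 mulr0 subr0 => /eqP.
  by rewrite oner_eq0.
pose z t := `|v t|^-1 *: v t.
have zK t : @bdsq R (z t).
  by rewrite bdsqE /= /z normrZ normfV normr_id mulVf.
have bN w : @bdsq R w -> @bdsq R (- w) by rewrite bdsqE /= normrN.
have cv : cont_on setT v.
  apply: cont_on_pair; first exact: cont_on_id.
  apply: cont_onB; first exact: cont_on_cst.
  by rewrite /GRing.exp/=; apply: cont_onM; exact: cont_on_id.
have cz : cont_on setT z.
  by apply: cont_onZ => //; apply: cont_onV => //; exact: cont_on_norm.
pose f t := ccross (s (- z t)) (s (z t)).
have c1 : cont_on setT (fun t => s (z t)) by apply: (cont_on_comp cz cs).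
have c2 : cont_on setT (fun t => s (- z t)).
  by apply: (cont_on_comp (f := fun t => - z t) _ cs) => [|t _]; [exact: cont_onN|exact: bN].
have cf : cont_on setT f.
  by apply: cont_onB; apply: cont_onM; do ?[exact: cont_on_fst|exact: cont_on_snd].
have f0 t : f t != 0.
  apply: cross_neq0; first by rewrite !sE//; [exact: godd|exact: bN].
  apply/eqP => sz; have := g0 _ (zK t); rewrite -sE// sz.
  by rewrite /cmul/= !mul0r subrr addr0 eqxx.
have zN : z (- 1) = - z 1.
  have e : v (- 1) = - v 1.
    by rewrite /v sqrrN expr1n subrr [RHS]surjective_pairing/= oppr0.
  by rewrite /z e normrN scalerN.
have fN : f (- 1) = - f 1 by rewrite /f zN opprK /ccross; ring.
have [] : exists2 c, c \in `[(-1 : R), 1] & f c = 0.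
  apply: IVT; first by lra.
    by apply/cont_onP; apply: cont_onS cf.
  rewrite fN ge_min le_max.
  rewrite !oppr_le0 !oppr_ge0 orbC andbb.
  exact: le_total.
by move=> c _ /eqP; apply/negP.
Qed.

Lemma sq_compact : compact (@sq R).
Proof.
have -> : @sq R = `[(-1 : R), 1] `*` `[(-1 : R), 1].
  by apply/seteqP; split => -[x y]; rewrite /sq/= !in_itv.
by apply: compact_setX; exact: segment_compact.
Qed.

Lemma bdsq_compact : compact (@bdsq R).
Proof.
apply: (subclosed_compact _ sq_compact); last by move=> z [].
rewrite bdsqE; apply: (@preimage_closed _ _ (fun z : P => `|z|) [set 1]).
  by move=> z _; exact: norm_continuous.
exact: closed_eq.
Qed.

End Odd.

(** * Invariance of domain *)

Section IoD.
Context {R : realType}.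
Local Notation P := (R * R)%type.
Local Notation K := (@bdsq R).
Local Notation KI := (K `*` @unit_interval R).

Lemma sqZ (t : R) (z : P) : `|t| <= 1 -> sq z -> sq (t *: z).
Proof.
rewrite !sqE /= normrZ => t1 z1; rewrite -[1]mulr1.
by apply: ler_pM.
Qed.

Lemma bdsq_sq (z : P) : bdsq z -> sq z. Proof. by case. Qed.

Lemma osq_sq (z : P) : osq z -> sq z.
Proof. by rewrite osqE sqE => /ltW. Qed.

Lemma cont_on_scale (A : set (P * R)) (k : P * R -> R) :
  cont_on A k -> cont_on A (fun z : P * R => k z *: z.1).
Proof.
move=> ck; apply: cont_onZ => //.
by apply: (cont_on_fst (f := id)); exact: cont_on_id.
Qed.

Lemma cont_on_time (A : set (P * R)) : cont_on A snd.
Proof. by apply: (cont_on_snd (f := id)); exact: cont_on_id. Qed.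

Lemma cont_on_space (A : set (P * R)) : cont_on A fst.
Proof. by apply: (cont_on_fst (f := id)); exact: cont_on_id. Qed.

(* [f (z / (1 + t)) - f (- t z / (1 + t))] deforms [f z - f 0] into an odd map. *)
Lemma odd_degree (f : P -> P) : cont_on (@sq R) f ->
  (forall z, K z -> f z != f 0) ->
  (forall p q, @osq R p -> @osq R q -> f p = f q -> p = q) ->
  ~ has_sqrt K (fun z => f z - f 0).
Proof.
move=> cf fK fi hs.
pose H (z : P * R) : P := f ((1 + z.2)^-1 *: z.1) - f (- (z.2 / (1 + z.2)) *: z.1).
have t0 (t : R) : @unit_interval R t -> 1 + t != 0 by move=> /andP[? _]; apply: lt0r_neq0; lra.
have ci : cont_on KI (fun z => (1 + z.2)^-1).
  apply: cont_onV; first by move=> [z t] [_ /t0].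
  by apply: cont_onD; [exact: cont_on_cst|exact: cont_on_time].
have ti (t : R) : @unit_interval R t -> `|(1 + t)^-1| <= 1.
  by move=> /andP[t1 _]; rewrite ger0_norm ?invr_ge0 ?invf_le1; lra.
have tj (t : R) : @unit_interval R t -> `|- (t / (1 + t))| < 1.
  move=> /andP[t1 t2]; rewrite normrN ger0_norm; last by apply: divr_ge0; lra.
  by rewrite ltr_pdivrMr; lra.
have cH : cont_on KI H.
  apply: cont_onB.
  - apply: (cont_on_comp (f := fun z : P * R => (1 + z.2)^-1 *: z.1) _ cf).
      exact: cont_on_scale.
    by move=> [z t] [/= /bdsq_sq zK t01]; apply: sqZ => //; exact: ti.
  - apply: (cont_on_comp (f := fun z : P * R => - (z.2 / (1 + z.2)) *: z.1) _ cf).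
      by apply: cont_on_scale; apply: cont_onN; apply: cont_onM => //; exact: cont_on_time.
    by move=> [z t] [/= /bdsq_sq zK t01]; apply: sqZ => //; apply/ltW; exact: tj.
have H0 z : KI z -> H z != 0.
  case: z => z t [/= zK t01]; rewrite /H/= subr_eq0.
  have [->|tn0] := eqVneq t 0.
    by rewrite addr0 invr1 scale1r mul0r oppr0 scale0r; exact: fK.
  have := zK; rewrite bdsqE /= => z1.
  have zn0 : z != 0 by apply/eqP => z0; move: z1; rewrite z0 normr0 => /eqP; rewrite eq_sym oner_eq0.
  apply/eqP => /fi e.
  have {e} : (1 + t)^-1 *: z = - (t / (1 + t)) *: z.
    apply: e; rewrite osqE /= normrZ z1 mulr1; last exact: tj.
    have /andP[t1 t2] := t01.
    rewrite ger0_norm ?invr_ge0 ?invf_lt1; last by lra.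
    - by rewrite ltrDl lt_def tn0.
    - by lra.
  move=> /eqP; rewrite -subr_eq0 -scalerBl opprK scaler_eq0 (negbTE zn0) orbF.
  rewrite -[X in X + _]mul1r -mulrDl mulf_eq0 invr_eq0 orbb.
  by rewrite (negbTE (t0 _ t01)).
have : has_sqrt K (fun z => H (z, 1)).
  apply: has_sqrt_homotopy => //; first exact: bdsq_compact.
  apply: has_sqrt_eq hs => z _.
  by rewrite /H /= addr0 invr1 scale1r mul0r oppr0 scale0r.
apply: odd_no_sqrt.
- move=> z _; rewrite /H/= opprB !scalerN !scaleNr opprK.
  by congr (f _ - f _); rewrite ?mul1r ?opprK.
- by move=> z zK; apply: H0; split => //=; rewrite /unit_interval/= ler01 lexx.
Qed.

(** If [f] missed a point [q] close to [f 0], then the loop [f z - q] would shrink through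
    [f (t *: z) - q] to a constant and have a square root. Moving [q] to [f 0] inside a ball
    disjoint from the image of [bdsq] preserves the square root, which contradicts [odd_degree]. *)
Theorem invariance_of_domain_sq (f : P -> P) : cont_on (@sq R) f ->
  (forall p q, @sq R p -> @sq R q -> f p = f q -> p = q) ->
  nbhs (f 0) (f @` @sq R).
Proof.
move=> cf fi.
have s0 : @sq R 0 by rewrite sqE /= normr0.
have Kn0 z : K z -> z <> 0.
  by rewrite bdsqE /= => + z0; rewrite z0 normr0 => /eqP; rewrite eq_sym oner_eq0.
have fK z : K z -> f z != f 0.
  by move=> zK; apply/eqP => /fi e; apply: (Kn0 _ zK); apply: e => //; exact: bdsq_sq.
have cfK : cont_on K f by apply: cont_onS cf => z; exact: bdsq_sq.
have : nbhs (f 0) (~` (f @` K)).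
  apply: open_nbhs_nbhs; split; last by move=> [z zK] /eqP; apply/negP; exact: fK.
  apply: closed_openC; apply: compact_closed; first exact: norm_hausdorff.
  by apply: continuous_compact; [exact/cont_onP|exact: bdsq_compact].
move=> /nbhs_ballP[e /= e0 fe]; apply/nbhs_ballP; exists e => //= q qe.
apply: contrapT => nq; apply: (odd_degree cf fK).
  by move=> x y xs ys; apply: fi; exact: osq_sq.
(* [H1] contracts the loop around [q], and [H2] moves [q] to [f 0]. They are applied in reverse,
   starting from the loop around [f 0]. *)
pose H1 (z : P * R) : P := f (z.2 *: z.1) - q.
pose H2 (z : P * R) : P := f z.1 - (q + z.2 *: (f 0 - q)).
apply: (@has_sqrt_eq _ _ _ (fun z => H2 (z, 1))).
  by move=> z _; rewrite /H2/= scale1r [q + _]addrC subrK.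
apply: has_sqrt_homotopy; first exact: bdsq_compact.
- apply: cont_onB.
    by apply: (cont_on_comp (f := fst) _ cfK); [exact: cont_on_space|move=> ? []].
  apply: cont_onD; first exact: cont_on_cst.
  by apply: cont_onZ; [exact: cont_on_time|exact: cont_on_cst].
- move=> [z t] [/= zK /andP[/= t1 t2]]; rewrite subr_eq0; apply/eqP => fz.
  apply: (fe (f z)); last by exists z.
  rewrite -ball_normE /=; rewrite fz opprD addrA -[X in X - _]scale1r -scalerBl normrZ.
  move: qe; rewrite -ball_normE /= => qe; apply: le_lt_trans qe.
  by rewrite ler_piMl// ger0_norm; lra.
apply: (@has_sqrt_eq _ _ _ (fun z => H1 (z, 1))).
  by move=> z _; rewrite /H2 /H1 /= scale1r scale0r addr0.
apply: has_sqrt_homotopy; first exact: bdsq_compact.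
- apply: cont_onB; last exact: cont_on_cst.
  apply: (cont_on_comp (f := fun z : P * R => z.2 *: z.1) _ cf).
    by apply: cont_on_scale; exact: cont_on_time.
  move=> [z t] [/= /bdsq_sq zK /andP[/= t1 t2]]; apply: sqZ => //.
  by rewrite ger0_norm.
- move=> [z t] [/= /bdsq_sq zK /andP[/= t1 t2]]; rewrite subr_eq0; apply/eqP => fz.
  apply: nq; exists (t *: z) => //; apply: sqZ => //.
  by rewrite ger0_norm.
apply: (@has_sqrt_eq _ _ _ (fun=> f 0 - q)); last exact: has_sqrt_cst.
by move=> z _; rewrite /H1 /= scale0r.
Qed.

(** Balls of the sup norm are squares, so a rescaled copy of the square around [p] fits into [U]. *)
Theorem invariance_of_domain (f : P -> P) (U : set P) (p : P) : open U -> U p ->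
  cont_on U f -> (forall x y, U x -> U y -> f x = f y -> x = y) ->
  nbhs (f p) (f @` U).
Proof.
move=> oU Up cf fi.
have /nbhs_ballP[e /= e0 eU] : nbhs p U by exact: open_nbhs_nbhs.
pose g (z : P) := f (p + (e / 2) *: z).
have gU z : @sq R z -> U (p + (e / 2) *: z).
  rewrite sqE /= => z1; apply: eU; rewrite -ball_normE /= opprD addrA subrr sub0r normrN normrZ.
  rewrite gtr0_norm ?divr_gt0//; apply: (@le_lt_trans _ _ (e / 2)); last by lra.
  by rewrite ler_piMr// divr_ge0// ltW.
have -> : f p = g 0 by rewrite /g scaler0 addr0.
apply: (@filterS _ _ _ (g @` @sq R)).
  by move=> _ [z zs <-]; exists (p + (e / 2) *: z) => //; exact: gU.
apply: invariance_of_domain_sq.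
  apply: (cont_on_comp (f := fun z : P => p + (e / 2) *: z) _ cf) => //.
  apply: cont_onD; first exact: cont_on_cst.
  by apply: cont_onZ; [exact: cont_on_cst|exact: cont_on_id].
move=> x y xs ys /fi e'; have /addrI : p + (e / 2) *: x = p + (e / 2) *: y.
  by apply: e'; exact: gU.
by apply: scalerI; rewrite gt_eqF// divr_gt0.
Qed.

End IoD.

(** * Preimages of floating sets under a permeation *)

Section Gap.
Context {R : realType}.
Local Notation P := (R * R)%type.
Local Notation K := (@bdsq R).
Local Notation I := (@unit_interval R).
Local Notation KI := (K `*` I).

(* [f] maps the top edge of the square into the arc [L], its corners to the end [h 1], and
   is otherwise injective and off [L].  Replacing the top edge by the constant [h 1] changes
   neither the parity of the winding number around [f 0], as [L] is contractible, nor, along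
   [f (0, t)] and then [L], that around [h 0]; the latter is even since the image lies
   on one side of [h 0]. *)
Lemma collapse_excluded (f : P -> P) (h : R -> P) (g : P -> R) (L : set P) (s : R) :
  homeo_pair I L h g -> cont_on (@sq R) f ->
  (forall p q, sq p -> sq q -> p.2 < 1 -> q.2 < 1 -> f p = f q -> p = q) ->
  (forall p, sq p -> p.2 < 1 -> ~ L (f p)) ->
  (forall x, `|x| <= 1 -> L (f (x, 1))) ->
  f (-1, 1) = h 1 -> f (1, 1) = h 1 -> f (0, 1) <> h 1 ->
  s * (h 0).2 = 1 -> s * (h 1).2 <= 1 -> (forall p, sq p -> s * (f p).2 <= 1) ->
  False.
Proof.
move=> [/cont_onP ch [/cont_onP cg [hI [gL [ghK hgK]]]]] cf fi fL fT fl fr f0 sa sb sf.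
have I0 : I 0 by rewrite /unit_interval/= lexx ler01.
have I1 : I 1 by rewrite /unit_interval/= lexx ler01.
have sq0 : @sq R 0 by rewrite sqE /= normr0.
have h01 : h 0 <> h 1.
  by move=> /(congr1 g); rewrite !ghK// => /eqP; rewrite eq_sym oner_eq0.
have tT (z : P) : z.2 = 1 -> sq z -> L (f z).
  by case: z => x y /= ->; rewrite sqE /= prod_normE/= ge_max => /andP[/fT].
have tlt (z : P) : sq z -> z.2 != 1 -> z.2 < 1.
  by case=> _ /andP[_ +] n; rewrite lt_def eq_sym n.
(* A parameter on [L] that runs from the end value 1 at time 0 to the parameter of [f z] at time 1.
   Thus [H] starts with the top edge collapsed to [h 1] and ends with [f]. *)
pose w (z : P) (t : R) := 1 - t * (1 - g (f z)).
have wI (z : P) t : L (f z) -> I t -> I (w z t).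
  move=> /gL /andP[/= g0 g1] /andP[/= t0 t1]; rewrite /unit_interval /= /w.
  have a : 0 <= t * (1 - g (f z)) by apply: mulr_ge0 => //; lra.
  have b : t * (1 - g (f z)) <= 1 by apply: mulr_ile1 => //; lra.
  by apply/andP; split; lra.
pose H (z : P * R) : P := if z.1.2 == 1 then h (w z.1 z.2) else f z.1.
have Htop z : sq z.1 -> z.1.2 = 1 -> I z.2 -> L (H z).
  move=> zs z1 zI; rewrite /H z1 eqxx; apply: hI; apply: wI => //; exact: tT.
have Hnot z : z.1.2 != 1 -> H z = f z.1 by rewrite /H => /negbTE ->.
have cH : cont_on KI H.
  (* The two formulas for [H] are glued along the top edge and the other three sides; they agree at
     the common corners, which [f] sends to [h 1]. *)
  pose T : set (P * R) := KI `&` [set z | z.1.2 = 1].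
  pose S : set (P * R) := KI `&` ([set z | `|z.1.1| = 1] `|` [set z | z.1.2 = -1]).
  have cKI : closed KI.
    apply: compact_closed; first exact: norm_hausdorff.
    by apply: compact_setX; [exact: bdsq_compact|exact: unit_interval_compact].
  have c2 : continuous (fun z : P * R => z.1.2).
    by apply: cont_onT; apply: cont_on_snd; apply: cont_on_space.
  have c1 : continuous (fun z : P * R => `|z.1.1|).
    by apply: cont_onT; apply: cont_on_norm; apply: cont_on_fst; apply: cont_on_space.
  have cl2 (v : R) : closed [set z : P * R | z.1.2 = v].
    by apply: (@preimage_closed _ _ (fun z : P * R => z.1.2) [set v]) => [? _|];
      [exact: c2|exact: closed_eq].
  have cl1 : closed [set z : P * R | `|z.1.1| = 1].
    by apply: (@preimage_closed _ _ (fun z : P * R => `|z.1.1|) [set 1]) => [? _|];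
      [exact: c1|exact: closed_eq].
  have cT : closed T by exact: closedI.
  have cS : closed S by apply: closedI => //; exact: closedU.
  have -> : KI = T `|` S.
    apply/seteqP; split; last by move=> z [[]|[]].
    move=> [z t] zt; have := zt.1; rewrite bdsqE /= prod_normE => zm.
    have [z2|z2] := eqVneq z.2 1; first by left.
    right; split => //=; move: zm.
    case: (leP `|z.1| `|z.2|) => _; last by left.
    move=> /eqP; rewrite eqr_norml ler01 andbT (negbTE z2) /= => /eqP ?; by right.
  apply: cont_onU => //.
  - apply: (@cont_on_eq _ _ _ (fun z => h (w z.1 z.2))).
      by move=> z [_ /= z1]; rewrite /H z1 eqxx.
    apply: (cont_on_comp (f := fun z : P * R => w z.1 z.2) _ ch).
      apply: cont_onB; first exact: cont_on_cst.
      apply: cont_onM; first exact: cont_on_time.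
      apply: cont_onB; first exact: cont_on_cst.
      apply: (cont_on_comp (f := fun z : P * R => f z.1) _ cg).
        apply: (cont_on_comp (f := fst) _ cf); first exact: cont_on_space.
        by move=> z [[/bdsq_sq]].
      by move=> z [[/bdsq_sq zs _] /= z1]; apply: tT.
    by move=> z [[/bdsq_sq zs zI] /= z1]; apply: wI => //; exact: tT.
  - apply: (@cont_on_eq _ _ _ (fun z => f z.1)).
      move=> [[x y] t] [[/= zs zI] /= z1]; rewrite /H/=; case: eqP => // y1.
      subst y; have {z1} : `|x| = 1 by case: z1 => // z1; exfalso; clear -z1; lra.
      move=> /eqP; rewrite eqr_norml ler01 andbT => /orP[]/eqP ->.
        by rewrite /w fr ghK// subrr mulr0 subr0.
      by rewrite /w fl ghK// subrr mulr0 subr0.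
    apply: (cont_on_comp (f := fst) _ cf); first exact: cont_on_space.
    by move=> z [[/bdsq_sq]].
pose r (z : P) := H (z, 0).
have rtop z : z.2 = 1 -> r z = h 1 by move=> z1; rewrite /r /H/= z1 eqxx /w mul0r subr0.
have cr : cont_on K r.
  apply: (cont_on_comp (f := fun z => (z, 0)) _ cH) => //.
  by apply: cont_on_pair; [exact: cont_on_id|exact: cont_on_cst].
have crT : cont_on KI (fun z => r z.1).
  by apply: (cont_on_comp (f := fst) _ cr); [exact: cont_on_space|move=> z []].
(* The collapsed loop can meet [L] only in [h 1], so a base point may travel along the rest of [L]
   without touching the loop. *)
have rL z p : sq z -> L p -> p <> h 1 -> r z <> p.
  move=> zs Lp p1; have [z1|z1] := eqVneq z.2 1; first by rewrite rtop// => e; apply: p1.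
  by rewrite /r Hnot// => e; apply: (fL z) => //; [exact: tlt|rewrite e].
have L01 : L (f (0, 1)) by apply: (fT 0); rewrite normr0.
have g01 : I (g (f (0, 1))) by exact: gL.
have g0lt : g (f (0, 1)) < 1.
  rewrite lt_def (andP g01).2 andbT; apply/eqP => e; apply: f0.
  by rewrite -[LHS]hgK// -e.
(* It remains to give [f z - f 0] a square root on the boundary. The homotopies are read backwards,
   from this loop down to a constant. *)
apply: (odd_degree cf).
- move=> z zK; have zs := bdsq_sq zK; apply/eqP => e.
  have L0 : ~ L (f 0) by apply: fL.
  have [z1|z1] := eqVneq z.2 1; first by apply: L0; rewrite -e; exact: tT.
  have z0 : z = 0 by apply: fi => //; exact: tlt.
  by move: zK; rewrite z0 bdsqE /= normr0 => /eqP; rewrite eq_sym oner_eq0.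
- move=> p q ps qs; have [_ /andP[_ p2]] := ps; have [_ /andP[_ q2]] := qs.
  by apply: fi => //; exact: osq_sq.
apply: (@has_sqrt_eq _ _ _ (fun z => H (z, 1) - f 0)).
  move=> z /bdsq_sq zs; rewrite /H/=; case: eqP => // z1; congr (_ - _).
  by rewrite /w mul1r opprB addrC subrK hgK//; apply: tT.
apply: (@has_sqrt_homotopy _ _ _ (fun z => H z - f 0)); first exact: bdsq_compact.
- by apply: cont_onB => //; exact: cont_on_cst.
- move=> z [zK zI]; have zs := bdsq_sq zK; rewrite subr_eq0; apply/eqP => e.
  have L0 : ~ L (f 0) by apply: fL.
  have [z1|z1] := eqVneq z.1.2 1; first by apply: L0; rewrite -e; exact: Htop.
  have z0 : z.1 = 0 by apply: fi => //; [exact: tlt|rewrite -e Hnot].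
  by move: zK; rewrite z0 bdsqE /= normr0 => /eqP; rewrite eq_sym oner_eq0.
apply: (@has_sqrt_eq _ _ _ (fun z => r z - f (0, 1 - 1))).
  by move=> z _; rewrite subrr.
(* The base point goes from [f 0] to the point [f (0, 1)] of [L], along the image of a vertical
   segment. *)
pose H1 (z : P * R) := r z.1 - f (0, 1 - z.2).
have ps t : I t -> sq ((0, 1 - t) : P).
  by move=> /andP[/= t0 t1]; rewrite /sq/=; split; apply/andP; split; lra.
apply: (@has_sqrt_homotopy _ _ _ H1); first exact: bdsq_compact.
- apply: cont_onB => //.
  apply: (cont_on_comp (f := fun z : P * R => (0, 1 - z.2)) _ cf).
    apply: cont_on_pair; first exact: cont_on_cst.
    by apply: cont_onB; [exact: cont_on_cst|exact: cont_on_time].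
  by move=> z [_ zI]; exact: ps.
- move=> [z t] [/= zK tI]; have zs := bdsq_sq zK; rewrite /H1/= subr_eq0; apply/eqP.
  have [->|t0] := eqVneq t 0.
    by rewrite subr0; apply: rL => //; exact: L01.
  have tp : 1 - t < 1 by have /andP[/= t1 _] := tI; rewrite ltrBlDr ltrDl lt_def t0.
  have Lt : ~ L (f (0, 1 - t)) by apply: fL => //; exact: ps.
  have [z1|z1] := eqVneq z.2 1; first by rewrite rtop// => e; apply: Lt; rewrite -e; exact: hI.
  rewrite /r Hnot//= => /fi; move=> /(_ zs (ps _ tI) (tlt _ zs z1) tp) ze.
  move: zK; rewrite ze bdsqE /= prod_normE/= normr0.
  have /andP[/= t1 t2] := tI; rewrite ger0_norm ?subr_ge0// max_r ?subr_ge0// => e; clear -tp e; lra.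
apply: (@has_sqrt_eq _ _ _ (fun z => r z - h (1 * g (f (0, 1))))).
  by move=> z _; rewrite /H1 /= subr0 mul1r hgK//; exact: L01.
have tg t : I t -> I (t * g (f (0, 1))).
  have /andP[/= u0 u1] := g01; move=> /andP[/= t0 t1]; rewrite /unit_interval/=.
  by rewrite mulr_ge0//= mulr_ile1.
(* The base point continues along [L] to the end [h 0]; its parameter is at most that of [f (0, 1)],
   hence below 1 and away from [h 1]. *)
pose H2 (z : P * R) := r z.1 - h (z.2 * g (f (0, 1))).
apply: (@has_sqrt_homotopy _ _ _ H2); first exact: bdsq_compact.
- apply: cont_onB => //.
  apply: (cont_on_comp (f := fun z : P * R => z.2 * g (f (0, 1))) _ ch).
    by apply: cont_onM; [exact: cont_on_time|exact: cont_on_cst].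
  by move=> z [_ zI]; exact: tg.
- move=> [z t] [/= zK tI]; have zs := bdsq_sq zK; rewrite /H2/= subr_eq0; apply/eqP.
  apply: rL => //; first by apply: hI; exact: tg.
  move=> /(congr1 g); rewrite !ghK//; last exact: tg.
  have /andP[/= u0 u1] := g01; have /andP[/= t0 t1] := tI => e.
  have : t * g (f (0, 1)) <= g (f (0, 1)) by exact: ler_piMl.
  by lra.
apply: (@has_sqrt_eq _ _ _ (fun z => (1 : R) *: (r z - h 0) + (1 - 1) *: (0, - s))).
  by move=> z _; rewrite /H2 /= mul0r subrr scale0r addr0 scale1r.
(* [h 0] lies on the line [s * y = 1] and the loop in the half-plane [s * y <= 1], so the segment
   from [r z - h 0] to [(0, - s)] misses the origin. *)
pose H3 (z : P * R) : P := z.2 *: (r z.1 - h 0) + (1 - z.2) *: (0, - s).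
apply: (@has_sqrt_homotopy _ _ _ H3); first exact: bdsq_compact.
- apply: cont_onD; apply: cont_onZ.
  + exact: cont_on_time.
  + by apply: cont_onB => //; exact: cont_on_cst.
  + by apply: cont_onB; [exact: cont_on_cst|exact: cont_on_time].
  + exact: cont_on_cst.
- move=> [z t] [/= zK /andP[/= t0 t1]]; have zs := bdsq_sq zK; rewrite /H3/=.
  have [->|tn1] := eqVneq t 1.
    by rewrite subrr scale0r addr0 scale1r subr_eq0; apply/eqP; apply: rL => //; apply: hI.
  apply/eqP => /(congr1 snd) e0.
  have e : t * ((r z).2 - (h 0).2) + (1 - t) * - s = 0 by exact: e0.
  clear e0.
  have s2 : 0 < s ^+ 2.
    rewrite exprn_even_gt0//=; apply/eqP => s0; move: sa; rewrite s0 mul0r => /eqP.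
    by rewrite eq_sym oner_eq0.
  have sr : s * (r z).2 <= 1.
    have [z1|z1] := eqVneq z.2 1; first by rewrite rtop.
    by rewrite /r Hnot//; exact: sf.
  have tlt1 : t < 1 by rewrite lt_def eq_sym tn1.
  have : t * (s * (r z).2 - s * (h 0).2) - (1 - t) * s ^+ 2 = 0.
    transitivity (s * (t * ((r z).2 - (h 0).2) + (1 - t) * - s)); first by ring.
    by rewrite e mulr0.
  rewrite sa => e2.
  have : t * (s * (r z).2 - 1) <= 0 by apply: mulr_ge0_le0 => //; lra.
  have : 0 < (1 - t) * s ^+ 2 by apply: mulr_gt0 => //; lra.
  lra.
apply: (@has_sqrt_eq _ _ _ (fun=> (0, - s))); last exact: has_sqrt_cst.
by move=> z _; rewrite /H3 /= scale0r add0r subr0 scale1r.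
Qed.

End Gap.

(** * Hutches and the maps that open them *)

Section Hutch.
Context {R : realType}.
Local Notation P := (R * R)%type.

Definition hseg (a b s : R) : set P := [set p | a <= p.1 <= b /\ p.2 = s].

Lemma compact_connected_hseg (A : set P) (s : R) : A !=set0 -> compact A ->
  connected A -> A `<=` [set p | p.2 = s] -> exists a b, a <= b /\ A = hseg a b s.
Proof.
move=> A0 cA kA As.
have cf : {within A, continuous (fst : P -> R)} by apply/cont_onP; exact: cont_on_fst_id.
have [p /set_mem pA pmax] := compact_EVT_max A0 cA cf.
have [q /set_mem qA qmin] := compact_EVT_min A0 cA cf.
have : is_interval (fst @` A) by apply/connected_intervalP; exact: connected_continuous_connected.
move=> iA; exists q.1, p.1; split; first exact/qmin/mem_set.
apply/seteqP; split => [x xA|[x y] /= [qxp ys]].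
  by split; [rewrite qmin ?pmax//; exact/mem_set|exact: As].
have [] : (fst @` A) x by apply: (iA q.1 p.1) => //; [exists q|exists p].
move=> [x' y'] xyA /= e; subst; have /= ys := As _ xyA.
by rewrite -ys.
Qed.

Lemma arc_compact (A : set P) : is_arc A -> compact A.
Proof.
move=> [a [b [h [g [[ch [cg [hA [gI [_ hg]]]]] _]]]]].
have -> : A = h @` @unit_interval R.
  by apply/seteqP; split => [x xA|_ [t tI <-]]; [exists (g x); [exact: gI|exact: hg]|exact: hA].
by apply: continuous_compact => //; exact: unit_interval_compact.
Qed.

Lemma arc_connected (A : set P) : is_arc A -> connected A.
Proof.
move=> [a [b [h [g [[ch [cg [hA [gI [_ hg]]]]] _]]]]].
have -> : A = h @` @unit_interval R.
  by apply/seteqP; split => [x xA|_ [t tI <-]]; [exists (g x); [exact: gI|exact: hg]|exact: hA].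
apply: connected_continuous_connected => //.
by rewrite unit_intervalE; exact: segment_connected.
Qed.

Lemma arc_nontrivial (A : set P) : is_arc A -> exists p q, A p /\ A q /\ p <> q.
Proof.
move=> [a [b [h [g [[ch [cg [hA [gI [gh hg]]]]] _]]]]].
have I0 : @unit_interval R 0 by rewrite /unit_interval/= lexx ler01.
have I1 : @unit_interval R 1 by rewrite /unit_interval/= lexx ler01.
exists (h 0), (h 1); split; first exact: hA.
split; first exact: hA.
by move=> /(congr1 g); rewrite !gh// => /eqP; rewrite eq_sym oner_eq0.
Qed.

Lemma arc_hseg (A : set P) (s : R) : is_arc A -> A `<=` [set p | p.2 = s] ->
  exists a b, a < b /\ A = hseg a b s.
Proof.
move=> arcA As; have [p [q [Ap [Aq pq]]]] := arc_nontrivial arcA.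
have [|a [b [ab Ae]]] := @compact_connected_hseg A s _ (arc_compact arcA) (arc_connected arcA) As.
  by exists p.
exists a, b; split => //; rewrite lt_def ab andbT; apply/eqP => e; subst b.
apply: pq; move: Ap Aq; rewrite Ae => -[/le_anti p1 p2] [/le_anti q1 q2].
by rewrite [p]surjective_pairing [q]surjective_pairing -p1 -q1 p2 q2.
Qed.

Lemma hseg_arc_ends (a b s : R) : a < b -> arc_ends (hseg a b s) (a, s) (b, s).
Proof.
move=> ab; have ba0 : b - a != 0 by rewrite subr_eq0 gt_eqF.
exists (fun t => (a + t * (b - a), s)), (fun p => (p.1 - a) / (b - a)).
split; last by rewrite mul0r addr0 mul1r addrC subrK.
split; [|split; [|split; [|split; [|split]]]].
- apply/cont_onP; apply: cont_on_pair; last exact: cont_on_cst.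
  apply: cont_onD; first exact: cont_on_cst.
  by apply: cont_onM; [exact: cont_on_id|exact: cont_on_cst].
- apply/cont_onP; apply: cont_onM; last exact: cont_on_cst.
  by apply: cont_onB; [exact: cont_on_fst_id|exact: cont_on_cst].
- move=> t /andP[/= t0 t1]; split => //=; apply/andP; split.
    by rewrite lerDl mulr_ge0// subr_ge0 ltW.
  by rewrite -lerBrDl ler_piMl// subr_ge0 ltW.
- move=> p [/andP[/= p1 p2] _]; rewrite /unit_interval/=.
  by rewrite divr_ge0 ?subr_ge0 ?(ltW ab)//= ler_pdivrMr ?subr_gt0// mul1r lerB.
- by move=> t _ /=; rewrite addrC addKr mulfK.
- by move=> [x y] [/= _ ->]; rewrite divfK// addrC subrK.
Qed.

Lemma arc_int_hseg (a b s : R) (p : P) : a < b -> arc_int (hseg a b s) p ->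
  a < p.1 < b /\ p.2 = s.
Proof.
move=> ab [[/andP[p1 p2] ps] /(_ _ _ (hseg_arc_ends s ab)) [na nb]]; split => //.
rewrite !lt_def p1 p2 !andbT; apply/andP; split; apply/eqP => e.
  by apply: na; rewrite [p]surjective_pairing ps e.
by apply: nb; rewrite [p]surjective_pairing ps e.
Qed.

(** A point of norm 1 could be pushed radially out of the square while staying in the
    neighbourhood. *)
Lemma sq_interior (p : P) : nbhs p (@sq R) -> osq p.
Proof.
move=> /nbhs_ballP[e /= e0 eS]; rewrite osqE /=.
have p1 : `|p| <= 1.
  by have := eS p (ballxx _ e0); rewrite sqE.
have [->|p0] := eqVneq p 0; first by rewrite normr0.
have : sq (p + (e / 2 / `|p|) *: p).
  apply: eS; rewrite -ball_normE /= opprD addrA subrr sub0r normrN normrZ.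
  rewrite gtr0_norm ?divr_gt0 ?normr_gt0//.
  by rewrite divfK ?normr_eq0// ltr_pdivrMr// ltr_pMr// ltr1n.
rewrite sqE /= -[X in X + _]scale1r -scalerDl normrZ gtr0_norm; last first.
  by rewrite addr_gt0// divr_gt0 ?normr_gt0// divr_gt0.
rewrite mulrDl mul1r divfK ?normr_eq0//; have : 0 < e / 2 by exact: divr_gt0.
by clear; lra.
Qed.

Lemma Js_bdsq (s : R) (p : P) : `|s| = 1 -> Js s p -> bdsq p.
Proof.
case: p => x y s1 [/= x1 ys]; subst y; rewrite bdsqE /= prod_normE/= s1.
by rewrite max_r// ler_norml.
Qed.

Lemma Jso_Js (s : R) (p : P) : Jso s p -> Js s p.
Proof. by move=> [/andP[a b] c]; split => //; rewrite !ltW. Qed.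

(* The parametrization of [D] by the unit disc is extended across the arc [D `&` bdsq] by
   vertical lines leaving the square; the extension [G] is injective, hence open. *)
Lemma hutch_nbhs (s : R) (D : set P) (p : P) : `|s| = 1 -> is_disc D -> D `<=` @sq R ->
  D `&` @bdsq R `<=` Jso s -> is_arc (D `&` @bdsq R) -> arc_int (D `&` Js s) p ->
  within (@sq R) (nbhs p) D.
Proof.
move=> s1 [h [g [ch0 [cg0 [hD [gU [gh hg]]]]]]] Dsq Dbd arcA.
have /cont_onP ch := ch0; have /cont_onP cg := cg0.
have ADE : D `&` Js s = D `&` @bdsq R.
  apply/seteqP; split => q [Dq qs]; split => //; first exact: Js_bdsq qs.
  by apply: Jso_Js; apply: Dbd.
have [a [b [ab Ae]]] : exists a b, a < b /\ D `&` @bdsq R = hseg a b s.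
  by apply: arc_hseg => // q /Dbd [].
rewrite ADE Ae => /(arc_int_hseg ab) [pab ps].
have segD u : a <= u <= b -> D (u, s) /\ bdsq (u, s).
  by move=> uab; have : hseg a b s (u, s) by []; rewrite -Ae.
have ss : s * s = 1 by rewrite -expr2 -real_normK ?num_real// s1 expr1n.
have sy q : sq q -> s * q.2 <= 1.
  rewrite sqE /= prod_normE ge_max => /andP[_ q2].
  by apply: le_trans (ler_norm _) _; rewrite normrM s1 mul1r.
pose k u : P := g (u, s).
pose N (z : P) := z.1 ^+ 2 + z.2 ^+ 2.
have cN : continuous N.
  apply: cont_onT; rewrite /N /GRing.exp/=; apply: cont_onD; apply: cont_onM;
  do ?[exact: cont_on_fst_id|exact: cont_on_snd_id].
(* Points of the arc have their parameters on the unit circle: otherwise invariance of domain would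
   make them interior to the square. *)
have kN u : a <= u <= b -> N (k u) = 1.
  move=> uab; have [Du bu] := segD u uab.
  apply: le_anti; rewrite (gU _ Du) /= leNgt; apply/negP => lt1.
  have : nbhs (h (k u)) (h @` [set z | N z < 1]).
    apply: invariance_of_domain => //.
    - by apply: (@open_comp _ _ N [set r | r < 1]) => [? _|]; [exact: cN|exact: open_lt].
    - by apply: cont_onS ch => z /= /ltW.
    - by move=> x y /= /ltW x1 /ltW y1 /(congr1 g); rewrite !gh.
  rewrite /k hg// => nb; have : osq (u, s).
    apply: sq_interior; apply: filterS nb => _ [z /= /ltW zU <-].
    exact/Dsq/hD.
  by case: bu.
have NZ r z : N (r *: z) = r ^+ 2 * N z by rewrite /N/= !exprMn mulrDr.
(* The first coordinate [u] runs along the arc, the second along the radius through [k u]; beyond 1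
   the radius is continued by the vertical line through [(u, s)]. *)
pose G (z : P) : P := if z.2 <= 1 then h (z.2 *: k z.1) else (z.1, s * z.2).
have rk u r : a <= u <= b -> 0 <= r <= 1 -> unit_disc (r *: k u).
  by move=> uab /andP[r0 r1]; change (N (r *: k u) <= 1); rewrite NZ kN// mulr1 expr_le1.
have ck : cont_on [set z : P | a <= z.1 <= b] (fun z => k z.1).
  apply: (cont_on_comp (f := fun z : P => (z.1, s)) _ cg).
    by apply: cont_on_pair; [exact: cont_on_fst_id|exact: cont_on_cst].
  by move=> z /segD[].
have cG : cont_on [set z : P | a < z.1 < b /\ 0 < z.2 < 2] G.
  apply: (@cont_onS _ _ _ (`[a, b] `*` `[(0 : R), 1] `|` `[a, b] `*` `[(1 : R), 2])).
    move=> [u r] /= [/andP[u1 u2] /andP[r1 r2]].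
    by case: (leP r 1) => r3; [left|right]; split; rewrite /= in_itv/=; apply/andP; split => //; exact: ltW.
  have cl (c d : R) : closed (`[a, b] `*` `[c, d]).
    apply: compact_closed; first exact: norm_hausdorff.
    by apply: compact_setX; exact: segment_compact.
  apply: cont_onU; [exact: cl|exact: cl| |].
  - apply: (@cont_on_eq P P _ (fun z : P => h (z.2 *: k z.1))).
      by move=> [u r] [/= _]; rewrite in_itv/= /G/= => /andP[_ ->].
    apply: (cont_on_comp (f := fun z : P => z.2 *: k z.1) _ ch).
      apply: cont_onZ; first exact: cont_on_snd_id.
      by apply: cont_onS ck => -[u r] [/=]; rewrite in_itv.
    by move=> [u r] [/=]; rewrite !in_itv/=; exact: rk.
  - apply: (@cont_on_eq P P _ (fun z : P => (z.1, s * z.2))).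
      move=> [u r] [/=]; rewrite !in_itv/= /G/= => uab /andP[r1 r2].
      case: ifPn => // r1'; have -> : r = 1 by apply: le_anti; rewrite r1 r1'.
      by rewrite scale1r mulr1 /k hg//; have [] := segD u uab.
    apply: cont_on_pair; first exact: cont_on_fst_id.
    by apply: cont_onM; [exact: cont_on_cst|exact: cont_on_snd_id].
have Glo u r : a < u < b -> 0 < r -> r <= 1 -> D (G (u, r)).
  move=> /andP[u1 u2] r0 r1; rewrite /G/= r1; apply/hD/rk; first by rewrite !ltW.
  by rewrite ltW.
have Ghi u r : 1 < r -> G (u, r) = (u, s * r) by move=> r1; rewrite /G/= leNgt r1.
have Ghi2 u r : 1 < r -> s * (G (u, r)).2 = r by move=> r1; rewrite Ghi//= mulrA ss mul1r.
have nG : nbhs (G (p.1, 1)) (G @` [set z : P | a < z.1 < b /\ 0 < z.2 < 2]).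
  apply: invariance_of_domain => //.
  - have -> : [set z : P | a < z.1 < b /\ 0 < z.2 < 2] =
        (fst : P -> R) @^-1` `]a, b[ `&` (snd : P -> R) @^-1` `](0 : R), 2[.
      by apply/seteqP; split => -[u r] /=; rewrite !in_itv/=.
    apply: openI; apply: open_comp; [|exact: itv_open| |exact: itv_open].
      by move=> ? _; exact: cvg_fst.
    by move=> ? _; exact: cvg_snd.
  - by split => //=; rewrite ltr01 ltr1n.
  - move=> [u r] [u' r'] /= [uab /andP[r0 r2]] [uab' /andP[r0' r2']] e.
    have s0 : s != 0 by rewrite -normr_eq0 s1 oner_eq0.
    case: (leP r 1) (leP r' 1) => [r1|r1] [r1'|r1'].
    + move: e; rewrite /G/= r1 r1' => /(congr1 g).
      have wk c : a < c < b -> a <= c <= b by move=> /andP[? ?]; rewrite !ltW.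
      rewrite !gh; [|by apply: rk; [exact: wk|rewrite ltW..]..] => e.
      have re : r = r'.
        move/(congr1 N): (e); rewrite !NZ !kN ?mulr1; [|exact: wk..] => /eqP.
        by rewrite eqrXn2// ?ltW// => /eqP.
      move: e; rewrite re => /scalerI ee.
      have /(congr1 h) : k u = k u' by apply: ee; rewrite gt_eqF.
      rewrite /k !hg; first by move=> [->].
      * by have [] := segD u' (wk _ uab').
      * by have [] := segD u (wk _ uab).
    + have := sy _ (Dsq _ (Glo _ _ uab r0 r1)); rewrite e Ghi2//.
      by rewrite leNgt r1'.
    + have := sy _ (Dsq _ (Glo _ _ uab' r0' r1')); rewrite -e Ghi2//.
      by rewrite leNgt r1.
    + by move: e; rewrite !Ghi// => -[-> /(mulfI s0) ->].
have pE : G (p.1, 1) = p.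
  rewrite /G/= lexx scale1r /k hg; first by rewrite -ps -surjective_pairing.
  by have /andP[p1 p2] := pab; have [] := segD p.1 _; rewrite ?ltW.
(* A point of the image of [G] that lies in the square has second parameter at most 1, hence belongs
   to [D]. *)
rewrite pE in nG; apply: filterS nG => _ [[u r] /= [uab /andP[r0 r2]] <-] qs.
have [r1|r1] := leP r 1; first exact: Glo.
by have := sy _ qs; rewrite Ghi2// leNgt r1.
Qed.

End Hutch.

Lemma closed_cont_on (T U : topologicalType) (A : set T) (f : T -> U) (C : set U) :
  closed A -> cont_on A f -> closed C -> closed (A `&` f @^-1` C).
Proof.
move=> cA /cont_onP /continuous_closedP cf /cf /closed_subspaceP [V cV VE].
by rewrite setIC -VE; exact: closedI.
Qed.

Lemma compact_cont_on (T U : topologicalType) (A : set T) (f : T -> U) (C : set U) :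
  closed A -> compact A -> cont_on A f -> closed C -> compact (A `&` f @^-1` C).
Proof.
move=> clA cA cf cC; apply: (subclosed_compact _ cA); last by move=> ? [].
exact: closed_cont_on.
Qed.

(** * The segment of the side that is mapped onto a floating set *)

Section FloatingPreimage.
Context {R : realType}.
Local Notation P := (R * R)%type.

(** Compactness of the segment makes the height [d] of the strip uniform. Inside the open square a
    neighbourhood relative to the square is a genuine one, which yields interior points of [D]. *)
Lemma hseg_uniform_interior (s u v : R) (D : set P) : `|s| = 1 ->
  (forall x, u <= x <= v -> within (@sq R) (nbhs (x, s)) D) -> -1 < u -> v < 1 ->
  exists2 d : R, 0 < d < 1 & forall x y, u <= x <= v -> 1 - d < s * y < 1 -> D° (x, y).
Proof.
move=> s1 HN u1 v1.
have ss : s * s = 1 by rewrite -expr2 -real_normK ?num_real// s1 expr1n.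
pose Q (d x : R) := u <= x <= v -> forall y, 1 - d < s * y < 1 -> D° (x, y).
have : \forall d \near (0 : R)^'+, `[u, v] `<=` Q d.
  apply: (iffLR (compact_near_coveringP _) (@segment_compact _ u v)).
  move=> x /=; rewrite in_itv/= => xuv; have /nbhs_ballP[e /= e0 eD] := HN x xuv.
  exists (ball x e, [set d | d < Num.min e 1]) => /=.
    split; first exact: nbhsx_ballx.
    by apply: nbhs_right_lt; rewrite lt_min e0 ltr01.
  move=> [x' d] /= [xx' de] x'uv y /andP[y1 y2].
  move: de; rewrite lt_min => /andP[de d1].
  rewrite /interior; apply: (@filterS _ _ _ (ball (x, s) e `&` @osq R)).
    by move=> q [qe /osq_sq qs]; apply: eD.
  apply: open_nbhs_nbhs; split.
    apply: openI; first exact: ball_open.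
    rewrite osqE; apply: (@open_comp _ _ (fun z : P => `|z|) [set r | r < 1]) => [z _|].
      exact: norm_continuous.
    exact: open_lt.
  split.
    split => //=; rewrite /ball/= -[s - y]mul1r -ss -mulrA mulrBr ss normrM s1 mul1r.
    by rewrite gtr0_norm; lra.
  split => /=.
    by have /andP[p1 p2] := x'uv; rewrite (lt_le_trans u1 p1) (le_lt_trans p2 v1).
  rewrite -ltr_norml -[y]mul1r -ss -mulrA normrM s1 mul1r.
  by rewrite gtr0_norm//; lra.
move=> h; have [d [[d0 d1] dQ]] := filter_ex (filterI (filterI (nbhs_right_gt (0:R)) (nbhs_right_lt ltr01)) h).
by exists d; [rewrite d0 d1|move=> x y xuv; apply: dQ => //; rewrite /= in_itv].
Qed.

(** [al] and [be] are the extreme parameters sent into [Y]. On a gap between them [eta] runs inside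
    the cable and reaches its end on [Y] at both ends of the gap; a thin rectangle based on the gap
    then contradicts [collapse_excluded]. *)
Lemma floating_preimage_hseg (s a b : R) (X D Y L : set P) (eta : P -> P) :
  `|s| = 1 -> D `<=` @sq R -> -1 < a -> b < 1 ->
  (forall x, a <= x <= b -> within (@sq R) (nbhs (x, s)) D) ->
  hseg a b s `<=` D ->
  cont_on D eta -> (forall p, D p -> D (eta p)) ->
  (forall p, D° p -> ~ X (eta p)) ->
  (forall p q, D° p -> D° q -> eta p = eta q -> p = q) ->
  eta @` hseg a b s = X -> floating Y -> cable s Y L -> X = Y `|` L ->
  exists al be, [/\ a <= al, al <= be, be <= b & eta @` hseg al be s = Y].
Proof.
move=> s1 Dsq a1 b1 HN segD ce eD eX ei eS [Y0 [cY [kY [Ysq Ybd]]]] [Lsq [p0 [p1 [[h [g [hp [h0 h1]]]] [Jp0 [Yp1 Ld]]]]]] XE.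
have ss : s * s = 1 by rewrite -expr2 -real_normK ?num_real// s1 expr1n.
have Lc : compact L by apply: arc_compact; exists p0, p1, h, g.
have hL t : @unit_interval R t -> L (h t) by case: hp => _ [_ [+ _]]; apply.
have Lp1 : L p1 by rewrite -h1; apply: hL; rewrite /unit_interval/= lexx ler01.
have LY q : L q -> Y q -> q = p1.
  move=> Lq Yq; apply: contrapT => q1.
  have [q0|q0] := pselect (q = p0).
    have : set0 q by rewrite -Ybd; split => //; apply: Js_bdsq s1 _; apply: Jso_Js; rewrite q0.
    by [].
  have : set0 q by rewrite -Ld; split; [split => // -[]//|right].
  by [].
have Yclosed : closed Y by apply: compact_closed => //; exact: norm_hausdorff.
have Lclosed : closed L by apply: compact_closed => //; exact: norm_hausdorff.
have segc u v : compact (hseg u v s).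
  have -> : hseg u v s = `[u, v] `*` [set s].
    by apply/seteqP; split => -[x y] /=; rewrite in_itv.
  by apply: compact_setX; [exact: segment_compact|exact: compact_set1].
have cxs (B : set R) : (forall x, B x -> a <= x <= b) -> cont_on B (fun x => eta (x, s)).
  move=> Bab; apply: (cont_on_comp (f := fun x : R => (x, s)) _ ce).
    by apply: cont_on_pair; [exact: cont_on_id|exact: cont_on_cst].
  by move=> x /Bab xab; exact: segD.
pose Q u v : set R := [set x | u <= x <= v /\ Y (eta (x, s))].
have Qc u v : a <= u -> v <= b -> compact (Q u v).
  move=> au vb; have -> : Q u v = `[u, v] `&` [set x | Y (eta (x, s))].
    by apply/seteqP; split => x /=; rewrite in_itv.
  apply: (@compact_cont_on _ _ _ (fun x => eta (x, s)) Y) => //.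
  - exact: itv_closed.
  - exact: segment_compact.
  - apply: cxs => x /=; rewrite in_itv/= => /andP[ux xv].
    by rewrite (le_trans au ux) (le_trans xv vb).
have Q0 : Q a b !=set0.
  have [y Yy] := Y0; have : (eta @` hseg a b s) y by rewrite eS XE; left.
  move=> [[x z] [/= xab zs] exy]; subst z; exists x; split => //.
  by rewrite exy.
have cid A : {within A, continuous (id : R -> R)} by apply/cont_onP; exact: cont_on_id.
have [be /set_mem [beab Ybe] bemax] := compact_EVT_max Q0 (Qc _ _ (lexx a) (lexx b)) (cid _).
have [al /set_mem [alab Yal] almin] := compact_EVT_min Q0 (Qc _ _ (lexx a) (lexx b)) (cid _).
have albe : al <= be by apply: almin; exact/mem_set.
exists al, be; split => //; [by case/andP: alab|by case/andP: beab|].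
suff H x : al <= x <= be -> Y (eta (x, s)).
  apply/seteqP; split => [_ [[x y] [/= xab ys] <-]|y Yy]; first by subst y; exact: H.
  have : (eta @` hseg a b s) y by rewrite eS XE; left.
  move=> [[x z] [/= xab zs] exy]; subst z; exists (x, s) => //; split => //=.
  by apply/andP; split; [apply: almin|apply: bemax]; apply/mem_set; split => //; rewrite exy.
move=> xab; apply: contrapT => nY.
have [/andP[aal _] /andP[_ beb]] := (alab, beab).
have /andP[alx xbe] := xab.
have Qu0 : Q al x !=set0 by exists al; split => //; rewrite lexx.
have Qv0 : Q x be !=set0 by exists be; split => //; rewrite lexx andbT.
(* [u] and [v] are the ends of the gap around [x]: the last parameter before [x] and the first one
   after it that are sent into [Y]. *)
have [u /set_mem [/andP[alu ux] Yu] umax] :=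
  compact_EVT_max Qu0 (Qc _ _ aal (le_trans xbe beb)) (cid _).
have [v /set_mem [/andP[xv vbe] Yv] vmin] :=
  compact_EVT_min Qv0 (Qc _ _ (le_trans aal alx) beb) (cid _).
have {}ux : u < x by rewrite lt_def ux andbT; apply/eqP => e; apply: nY; rewrite e.
have {}xv : x < v by rewrite lt_def xv andbT; apply/eqP => e; apply: nY; rewrite -e.
have au : a <= u by exact: le_trans alu.
have vb : v <= b by exact: le_trans beb.
have gap t : u < t < v -> ~ Y (eta (t, s)).
  move=> /andP[ut tv] Yt; have [tx|xt] := leP t x.
    have : t <= u by apply/umax/mem_set; split => //; rewrite tx andbT ltW// (le_lt_trans alu).
    by rewrite leNgt ut.
  have : v <= t by apply/vmin/mem_set; split => //; rewrite (ltW xt) ltW// (lt_le_trans tv).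
  by rewrite leNgt tv.
have inab t : u <= t <= v -> a <= t <= b.
  by move=> /andP[ut tv]; rewrite (le_trans au ut) (le_trans tv vb).
have gapL t : u < t < v -> L (eta (t, s)).
  move=> tuv; have : X (eta (t, s)).
    by rewrite -eS; exists (t, s) => //; split => //=; apply: inab; case/andP: tuv => *; rewrite !ltW.
  by rewrite XE => -[/(gap _ tuv)|].
have uv : u < v by exact: lt_trans xv.
(* The ends of the gap are limits of its points and [L] is closed, so they go into both [L] and [Y],
   that is to [p1]. *)
have endL t : u <= t <= v -> (forall e : R, 0 < e -> exists t', u < t' < v /\ `|t - t'| < e) -> L (eta (t, s)).
  move=> tuv ht; apply: contrapT => nL.
  have nLn : nbhs (eta (t, s)) (~` L) by apply: open_nbhs_nbhs; split => //; exact: closed_openC.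
  have /nbhs_ballP[e /= e0 he] := cxs [set t | u <= t <= v] inab t tuv _ nLn.
  have [t' [t'uv tt']] := ht e e0.
  apply: (he t') => //=; last exact: gapL.
  by case/andP: t'uv => *; rewrite !ltW.
have mid (e : R) : 0 < e -> exists d, 0 < d < v - u /\ d < e.
  move=> e0; exists (Num.min e (v - u) / 2).
  have m0 : 0 < Num.min e (v - u) by rewrite lt_min e0 subr_gt0.
  have me : Num.min e (v - u) <= e by rewrite ge_min lexx.
  have mv : Num.min e (v - u) <= v - u by rewrite ge_min lexx orbT.
  by split; [apply/andP; split|]; lra.
have eu : eta (u, s) = p1.
  apply: LY => //; apply: endL; first by rewrite lexx ltW.
  move=> e /mid[d [/andP[d0 dv] de]]; exists (u + d); split; first by apply/andP; split; lra.
  by rewrite opprD addrA subrr sub0r normrN gtr0_norm.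
have ev : eta (v, s) = p1.
  apply: LY => //; apply: endL; first by rewrite lexx ltW.
  move=> e /mid[d [/andP[d0 dv] de]]; exists (v - d); split; first by apply/andP; split; lra.
  by rewrite opprB addrCA subrr addr0 gtr0_norm.
have [|||d /andP[d0 d1] dI] := @hseg_uniform_interior s u v D s1.
- by move=> t /inab; exact: HN.
- exact: lt_le_trans au.
- exact: le_lt_trans b1.
pose m := (u + v) / 2; pose w := (v - u) / 2.
have w0 : 0 < w by rewrite /w; apply: divr_gt0 => //; lra.
(* An affine map of the square onto a rectangle of height [d / 2], taking the edge [z.2 = 1] onto
   the gap and everything else into the interior of [D]. *)
pose A (z : P) : P := (m + z.1 * w, s * (1 - d / 4 * (1 - z.2))).
have cA : cont_on (@sq R) A.
  apply: cont_on_pair.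
    apply: cont_onD; first exact: cont_on_cst.
    by apply: cont_onM; [exact: cont_on_fst_id|exact: cont_on_cst].
  apply: cont_onM; first exact: cont_on_cst.
  apply: cont_onB; first exact: cont_on_cst.
  apply: cont_onM; first exact: cont_on_cst.
  by apply: cont_onB; [exact: cont_on_cst|exact: cont_on_snd_id].
have Ax r : `|r| <= 1 -> u <= m + r * w <= v.
  rewrite ler_norml => /andP[r1 r2].
  have h1' : r * w <= w by apply: ler_piMl => //; exact: ltW.
  have h2' : - w <= r * w by rewrite -mulN1r ler_pM2r.
  by rewrite /m; rewrite /w in h1' h2' *; apply/andP; split; lra.
have AI z : sq z -> z.2 < 1 -> D° (A z).
  move=> [z1 /andP[z2 z3]] z4; apply: dI; first by apply: Ax; rewrite ler_norml.
  rewrite /= mulrA ss mul1r.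
  have h1' : d / 4 * (1 - z.2) > 0 by apply: mulr_gt0; [apply: divr_gt0|lra].
  have h2' : d / 4 * (1 - z.2) <= d / 4 * 2 by apply: ler_wpM2l; [apply: divr_ge0 => //; exact: ltW|lra].
  by apply/andP; split; lra.
have AT r : A (r, 1) = (m + r * w, s) by rewrite /A/= subrr mulr0 subr0 mulr1.
have AD z : sq z -> D (A z).
  case: z => z1 z2 zs; have [z21|z21] := ltP z2 1; first by apply: interior_subset; exact: AI.
  have -> : z2 = 1 by apply: le_anti; rewrite z21 andbT; case: zs => _ /andP[].
  rewrite AT; apply: segD; split => //=; apply/inab/Ax.
  by case: zs => /=; rewrite ler_norml.
have sy q : sq q -> s * q.2 <= 1.
  rewrite sqE /= prod_normE ge_max => /andP[_ q2].
  by apply: le_trans (ler_norm _) _; rewrite normrM s1 mul1r.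
have s0 : s != 0 by rewrite -normr_eq0 s1 oner_eq0.
have m1 : m + -1 * w = u by rewrite /m /w; field.
have m2 : m + 1 * w = v by rewrite /m /w; field.
have m0 : m + 0 * w = m by rewrite mul0r addr0.
have muv : u < m < v by rewrite /m; apply/andP; split; lra.
apply: (@collapse_excluded R (eta \o A) h g L s hp).
- exact: (cont_on_comp cA ce).
- move=> p q ps qs p2 q2 /= /ei e; have : A p = A q by apply: e; exact: AI.
  rewrite /A => -[/addrI /(mulIf (lt0r_neq0 w0)) e1].
  move=> /(mulfI s0) /addrI /oppr_inj /(mulfI _) e2.
  rewrite [p]surjective_pairing [q]surjective_pairing e1; congr pair.
  by have /addrI /oppr_inj : 1 - p.2 = 1 - q.2 by apply: e2; rewrite lt0r_neq0// divr_gt0.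
- move=> p ps p2 Lp; apply: (eX (A p)); first exact: AI.
  by rewrite XE; right.
- move=> r r1 /=; rewrite AT.
  have /andP := Ax r r1; rewrite !le_eqVlt => -[/orP[/eqP<-|h1'] ]; first by rewrite eu.
  move=> /orP[/eqP->|h2']; first by rewrite ev.
  by apply: gapL; rewrite h1' h2'.
- by rewrite /= AT m1 eu h1.
- by rewrite /= AT m2 ev h1.
- rewrite /= AT m0 h1 => e; apply: (gap m) => //; by rewrite e.
- by rewrite h0; have [_ ->] := Jp0.
- by rewrite h1; apply/sy/Ysq.
- by move=> p ps /=; apply/sy/Dsq/eD/AD.
Qed.

End FloatingPreimage.

Lemma cont_on_local (T U : topologicalType) (A B : set T) (f : T -> U) x :
  within A (nbhs x) B -> cont_on B f -> B x -> f @ within A (nbhs x) --> f x.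
Proof.
move=> AB cf Bx W /(cf x Bx) h.
by apply: (@filterS2 _ (nbhs x) _ _ _ _ _ h AB) => y h1 h2 Ay; apply: h1; apply: h2.
Qed.

(** * Permeations extended by the identity *)

Section Perm.
Context {R : realType}.
Local Notation P := (R * R)%type.

(** Collects what the assembly needs from a hutch and its permeation. [e] is the permeation
    continued by the identity, and [Z] is the set wanted as a limit set: [X] itself or its floating
    part. *)
Record opening (s : R) (X D Z : set P) (e : P -> P) (al be : R) : Prop := Opening {
  opening_cont : cont_on (@sq R) e;
  opening_out : forall p, ~ D p -> e p = p;
  opening_in : forall p, D p -> D (e p);
  opening_inj : forall p q, osq p -> osq q -> e p = e q -> p = q;
  opening_osq : forall p, osq p -> osq (e p) /\ ~ X (e p);
  opening_bd : forall p, bdsq p -> bdsq (e p) \/ X (e p);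
  opening_surj : forall q, sq q -> exists2 p, sq p & e p = q;
  opening_osq_surj : forall q, osq q -> ~ X q -> exists2 p, osq p & e p = q;
  opening_sub : X `<=` D;
  opening_trace : D `&` @bdsq R `<=` Jso s;
  opening_closed : closed D;
  opening_dsq : D `<=` @sq R;
  opening_al : -1 < al; opening_albe : al <= be; opening_be : be < 1;
  opening_seg : hseg al be s `<=` D;
  opening_img : e @` hseg al be s = Z
}.

(** The continuation of [eta] by the identity is continuous: a point of [D] at which [D] is not a
    neighbourhood relative to the square is neither interior to [D] nor, by [hutch_nbhs], inside the
    arc [A], so [eta] fixes it. *)
Lemma exists_opening (s : R) (X D Z : set P) : `|s| = 1 ->
  hanging s X -> hutch s X D -> permeable s X D ->
  (Z = X \/ exists L, floating Z /\ cable s Z L /\ X = Z `|` L) ->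
  exists e al be, opening s X D Z e al be.
Proof.
move=> s1 [X0 [cX [kX [Xsq [Xbd0 [Xbdk Xbd]]]]]].
move=> [Ddisc [Dsq [[_ [cD [kD [_ [_ [_ Dbd]]]]]] [Aarc [XA XD]]]]].
have Xo p : X p -> bdsq p -> arc_int (D `&` Js s) p.
  by move=> Xp bp; apply: XA; split => //; apply: Jso_Js; apply: Xbd.
move=> [eta [ce [eD [efix [eA [[A' [A'arc [A'A [_ [_ [eA' _]]]]]] [eint einj]]]]]]] HZ.
have bdE p : D p -> bdsq p <-> Js s p.
  by move=> Dp; split=> [bp|/(Js_bdsq s1)//]; apply: Jso_Js; apply: Dbd.
have clD : closed D by apply: compact_closed => //; exact: norm_hausdorff.
have XsubD : X `<=` D.
  move=> p Xp; have [Jp|nJp] := pselect (Js s p).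
    by have [[Dp _] _] := XA p (conj Xp Jp).
  by apply: interior_subset; apply: XD.
have intosq p : D° p -> osq p by move=> Dp; apply: sq_interior; apply: filterS Dp.
have HN p : arc_int (D `&` Js s) p -> within (@sq R) (nbhs p) D by exact: hutch_nbhs.
have einj' p q : D° p -> D° q -> eta p = eta q -> p = q.
  by move=> pi qi; apply: einj; exact/mem_set.
have eint' p : D° p -> D° (eta p) /\ ~ X (eta p).
  by move=> pi; have : (eta @` disc_int D) (eta p) by [exists p]; rewrite eint.
have eD' p : D p -> D (eta p) by move=> Dp; apply: eD; exists p.
have efix' p : D p -> ~ D° p -> ~ arc_int (D `&` Js s) p -> eta p = p.
  by move=> Dp ni na; apply: efix.
pose e (p : P) := if `[< D p >] then eta p else p.
have eI p : D p -> e p = eta p by move=> Dp; rewrite /e asboolT.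
have eO p : ~ D p -> e p = p by move=> Dp; rewrite /e asboolF.
have cont_eta : cont_on D eta by apply/cont_onP.
have osqN p : osq p -> ~ Js s p.
  by move=> po /(Js_bdsq s1) [_].
have [a [b [ab A'E]]] : exists a b, a < b /\ A' = hseg a b s.
  by apply: arc_hseg => // p /A'A [[_ []]].
have A'int p : hseg a b s p -> arc_int (D `&` Js s) p by rewrite -A'E; exact: A'A.
have segD : hseg a b s `<=` D by move=> p /A'int [[]].
have segJ x : a <= x <= b -> Jso s (x, s).
  move=> xab; apply: Dbd; have : hseg a b s (x, s) by [].
  by move=> /segD Dx; split => //; apply/bdE => //; have [[_]] := A'int _ (conj xab erefl : hseg a b s (x, s)).
have [/andP[a1 _] _] := segJ a (introT andP (conj (lexx a) (ltW ab))).
have [/andP[_ b1] _] := segJ b (introT andP (conj (ltW ab) (lexx b))).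
have [al [be [aal albe beb eZ]]] : exists al be,
    [/\ a <= al, al <= be, be <= b & eta @` hseg al be s = Z].
  (* For [Z = X] the whole arc [A'] serves, since [eta] maps it onto [X]. *)
  case: HZ => [->|[L [fZ [cL XE]]]].
    by exists a, b; split => //; [exact: ltW|rewrite -A'E].
  apply: (@floating_preimage_hseg _ s a b X D Z L eta) => //.
  - by move=> x xab; apply: HN; exact: A'int.
  - by move=> p /eint' [].
  - by rewrite -A'E.
have seg2 p : hseg al be s p -> hseg a b s p.
  by move=> [/andP[p1 p2] ps]; split => //; rewrite (le_trans aal p1) (le_trans p2 beb).
have einte p : D° p -> e p = eta p by move=> /interior_subset /eI.
have eoute p : osq p -> ~ D° p -> e p = p.
  move=> po ni; have [Dp|nDp] := pselect (D p); last exact: eO.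
  rewrite eI//; apply: efix' => // -[[_ Jp] _]; exact: osqN Jp.
have Xint p : osq p -> X p -> D° p by move=> po Xp; apply: XD; split => //; exact: osqN.
have osurj q : osq q -> ~ X q -> exists2 p, osq p & e p = q.
  move=> qo nXq; have [qi|qi] := pselect (D° q); last by exists q => //; exact: eoute.
  have : (disc_int D `\` X) q by [].
  by rewrite -eint => -[p pi <-]; exists p; [exact: intosq|exact: einte].
have Asurj q : (D `&` Js s `|` X) q -> exists2 p, sq p & e p = q.
  by rewrite -eA => -[p [Dp _] <-]; exists p; [exact: Dsq|exact: eI].
exists e, al, be; split.
- move=> p ps; have [Dp|nDp] := pselect (D p); last first.
    apply: (@cont_on_local _ _ (@sq R) (~` D)) => //.
      have : nbhs p (~` D) by apply: open_nbhs_nbhs; split => //; exact: closed_openC.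
      by apply: (@filterS _ (nbhs p)) => q.
    apply: (@cont_on_eq _ _ _ id); last exact: cont_on_id.
    by move=> q nDq; rewrite eO.
  have ceD : cont_on D e by apply: cont_on_eq cont_eta => q Dq; rewrite eI.
  have [Dn|nDn] := pselect (within (@sq R) (nbhs p) D).
    exact: (@cont_on_local _ _ (@sq R) D).
  have ep : e p = p.
    rewrite eI//; apply: efix' => //; last by move=> /HN.
    by move=> Di; apply: nDn; apply: (@filterS _ (nbhs p)) Di => q.
  move=> W; rewrite ep => Wp.
  have := ceD p Dp W; rewrite ep => /(_ Wp) /= h.
  apply: (@filterS2 _ (nbhs p) _ _ _ _ _ h Wp) => q h1 h2 qs.
  by have [Dq|nDq] := pselect (D q); [exact: h1|rewrite /= eO].
- exact: eO.
- by move=> p Dp; rewrite eI//; exact: eD'.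
- move=> p q po qo.
  have [pi|pi] := pselect (D° p); have [qi|qi] := pselect (D° q).
  + by rewrite !einte//; exact: einj'.
  + rewrite (einte p)// (eoute q)// => epq; exfalso; apply: qi.
    by rewrite -epq; have [] := eint' p pi.
  + rewrite (einte q)// (eoute p)// => epq; exfalso; apply: pi.
    by rewrite epq; have [] := eint' q qi.
  + by rewrite !eoute.
- move=> p po; have [pi|pi] := pselect (D° p).
    by rewrite einte//; have [? ?] := eint' p pi; split => //; exact: intosq.
  by rewrite eoute//; split => // /(Xint p po).
- move=> p pb; have [Dp|nDp] := pselect (D p); last by left; rewrite eO.
  have : (D `&` Js s `|` X) (eta p) by rewrite -eA; exists p => //; split => //; exact/bdE.
  by rewrite eI// => -[[_ /(Js_bdsq s1)]|]; [left|right].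
- move=> q qs; have [qo|qo] := pselect (osq q).
    have [Xq|nXq] := pselect (X q); first by apply: Asurj; right.
    by have [p po pq] := osurj q qo nXq; exists p => //; exact: osq_sq.
  have [Dq|nDq] := pselect (D q); last by exists q => //; exact: eO.
  by apply: Asurj; left; split => //; apply/bdE.
- exact: osurj.
- exact: XsubD.
- exact: Dbd.
- exact: clD.
- exact: Dsq.
- exact: lt_le_trans aal.
- exact: albe.
- exact: le_lt_trans b1.
- by move=> p /seg2 /segD.
- rewrite -eZ; apply/seteqP; split => [_ [p pS <-]|_ [p pS <-]]; exists p => //.
    by rewrite eI//; apply/segD/seg2.
  by rewrite eI//; apply/segD/seg2.
Qed.

End Perm.

(** * A homeomorphism with prescribed limit sets on the top and bottom sides *)

Section Affine.
Context {R : realType}.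
Local Notation P := (R * R)%type.
Implicit Types (x y a b t : R).

Definition line_of x := x / (1 - `|x|).

(* [s |-> a * s + b] in the coordinate [s = line_of x], extended continuously to [x = +-1]. *)
Definition aff a b x :=
  (a * x + b * (1 - `|x|)) / (1 - `|x| + `|a * x + b * (1 - `|x|)|).

Lemma aff_den x a b : `|x| <= 1 -> 0 < a ->
  0 < 1 - `|x| + `|a * x + b * (1 - `|x|)|.
Proof.
move=> x1 a0; have [xlt|xge] := ltP `|x| 1.
  by apply: ltr_wpDr => //; rewrite subr_gt0.
have -> : `|x| = 1 by apply: le_anti; rewrite x1 xge.
have x0 : x != 0 by rewrite -normr_gt0; exact: lt_le_trans xge.
by rewrite subrr mulr0 add0r addr0 normr_gt0 mulf_neq0// gt_eqF.
Qed.

Lemma aff_compl x a b : `|x| <= 1 -> 0 < a ->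
  1 - `|aff a b x| = (1 - `|x|) / (1 - `|x| + `|a * x + b * (1 - `|x|)|).
Proof.
move=> x1 a0; have d0 := aff_den b x1 a0.
rewrite /aff normrM normfV [`|_ + `|_| |]gtr0_norm// -[X in X - _](divff (lt0r_neq0 d0)).
by rewrite -mulrBl addrK.
Qed.

Lemma aff_le1 x a b : `|x| <= 1 -> 0 < a -> `|aff a b x| <= 1.
Proof.
move=> x1 a0; rewrite -subr_ge0 aff_compl// divr_ge0 ?subr_ge0//.
by apply/ltW/aff_den.
Qed.

Lemma aff_lt1 x a b : `|x| < 1 -> 0 < a -> `|aff a b x| < 1.
Proof.
move=> x1 a0; rewrite -subr_gt0 aff_compl ?(ltW x1)// divr_gt0 ?subr_gt0//.
by apply: aff_den => //; exact: ltW.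
Qed.

(** The composition law of affine maps of the line persists at the two added end points; it supplies
    the inverses. *)
Lemma aff_comp x a b a' b' : `|x| <= 1 -> 0 < a -> 0 < a' ->
  aff a' b' (aff a b x) = aff (a' * a) (a' * b + b') x.
Proof.
move=> x1 a0 a0'; have d0 := aff_den b x1 a0.
rewrite {1}/aff aff_compl//.
set N := a * x + b * (1 - `|x|); set D := 1 - `|x| + `|N|.
have -> : aff a b x = N / D by [].
have -> : a' * (N / D) + b' * ((1 - `|x|) / D) =
    (a' * a * x + (a' * b + b') * (1 - `|x|)) / D.
  by rewrite /N; field; rewrite -/N -/D gt_eqF.
rewrite /aff; set N' := a' * a * x + _.
rewrite normrM normfV [`|D|]gtr0_norm// -mulrDl.
have d0' : 0 < 1 - `|x| + `|N'| by apply: aff_den => //; exact: mulr_gt0.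
by field; rewrite !gt_eqF.
Qed.

Lemma aff10 x : aff 1 0 x = x.
Proof. by rewrite /aff mul1r mul0r addr0 subrK divr1. Qed.

Lemma affK x a b : `|x| <= 1 -> 0 < a -> aff a^-1 (- b / a) (aff a b x) = x.
Proof.
move=> x1 a0; rewrite aff_comp ?invr_gt0// mulVf ?gt_eqF//.
by rewrite [a^-1 * b]mulrC mulNr subrr aff10.
Qed.

Lemma aff_bd x b : `|x| = 1 -> aff 1 b x = x.
Proof. by move=> x1; rewrite /aff x1 subrr mulr0 mul1r addr0 add0r x1 divr1. Qed.

Lemma line_of_aff x a b : `|x| < 1 -> 0 < a -> line_of (aff a b x) = a * line_of x + b.
Proof.
move=> x1 a0; rewrite /line_of aff_compl ?(ltW x1)// /aff.
have d0 := aff_den b (ltW x1) a0.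
have x0 : 1 - `|x| != 0 by rewrite subr_eq0 gt_eqF.
by field; rewrite x0 gt_eqF.
Qed.

Definition of_line t := t / (1 + `|t|).

Lemma onenorm_gt0 t : 0 < 1 + `|t|.
Proof. by apply: ltr_wpDr. Qed.

Lemma of_line_compl t : 1 - `|of_line t| = (1 + `|t|)^-1.
Proof.
rewrite /of_line normrM normfV [`|1 + _|]gtr0_norm ?onenorm_gt0//.
rewrite -[X in X - _](divff (lt0r_neq0 (onenorm_gt0 t))) -mulrBl.
by rewrite addrK mul1r.
Qed.

Lemma line_ofK x : `|x| < 1 -> of_line (line_of x) = x.
Proof.
move=> x1; have x0 : 0 < 1 - `|x| by rewrite subr_gt0.
rewrite /of_line /line_of normrM normfV [`|1 - _|]gtr0_norm//.
by field; rewrite gt_eqF//= addrNK oner_eq0.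
Qed.

Lemma of_line_lip t u : `|of_line t - of_line u| <= `|t - u|.
Proof.
wlog: t u / u <= t.
  by move=> h; have [ut|/ltW tu] := leP u t; [exact: h|rewrite distrC [leRHS]distrC; exact: h].
move=> ut; rewrite /of_line.
have p0 := onenorm_gt0 t; have q0 := onenorm_gt0 u.
have -> : t / (1 + `|t|) - u / (1 + `|u|) =
  (t - u + (t * `|u| - u * `|t|)) / ((1 + `|t|) * (1 + `|u|)).
  by field; rewrite !gt_eqF.
rewrite normrM normfV [`|(1 + _) * _|]gtr0_norm ?mulr_gt0//.
rewrite ler_pdivrMr ?mulr_gt0// [`|t - u|]ger0_norm ?subr_ge0//.
have [t0|t0] := ger0P t; have [u0|u0] := ger0P u.
- have n0 : 0 <= t - u by rewrite subr_ge0.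
  have -> : t - u + (t * u - u * t) = t - u by ring.
  rewrite ger0_norm// ler_peMr//.
  have := mulr_ge0 t0 u0; clear -t0 u0; nra.
- have h1 : 0 <= - (t * u) by rewrite -mulrN mulr_ge0// oppr_ge0 ltW.
  have h2 : 0 <= (t - u) * - (t * u) by rewrite mulr_ge0// subr_ge0.
  have h3 := sqr_ge0 t; have h4 := sqr_ge0 u.
  rewrite ger0_norm; first by clear -h1 h2 h3 h4; nra.
  by clear -h1 ut; nra.
- by move: (le_lt_trans ut t0); rewrite ltNge u0.
- have -> : t - u + (t * - u - u * - t) = t - u by ring.
  have n0 : 0 <= t - u by rewrite subr_ge0.
  rewrite ger0_norm// ler_peMr//.
  have : 0 < t * u by rewrite nmulr_rgt0.
  clear -t0 u0; nra.
Qed.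

End Affine.

(** * The flow map and its phase *)

Section Flow.
Context {R : realType}.
Local Notation P := (R * R)%type.

Lemma cont_on_aff (T : topologicalType) (A : set T) (x a b : T -> R) :
  cont_on A x -> cont_on A a -> cont_on A b ->
  (forall p, A p -> `|x p| <= 1) -> (forall p, A p -> 0 < a p) ->
  cont_on A (fun p => aff (a p) (b p) (x p)).
Proof.
move=> cx ca cb x1 a0.
have cN : cont_on A (fun p => a p * x p + b p * (1 - `|x p|)).
  apply: cont_onD; apply: cont_onM => //.
  by apply: cont_onB; [exact: cont_on_cst|exact: cont_on_norm].
apply: cont_onM => //; apply: cont_onV.
  by move=> p Ap; rewrite lt0r_neq0// aff_den//; [exact: x1|exact: a0].
apply: cont_onD; last exact: cont_on_norm.
by apply: cont_onB; [exact: cont_on_cst|exact: cont_on_norm].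
Qed.

(** The limit at both ends of the line at once. *)
Definition tends (f : R -> R) (l : R) :=
  forall e, 0 < e -> exists M, forall t, M <= `|t| -> `|f t - l| < e.

Section Def.
Variables (c sg : R) (a b : R -> R).

(** The different powers of [c] make the difference of the phases of two distinct points of the open
    square a nonzero polynomial in [c]. *)
Definition phase (p : P) := c * line_of p.2 + c ^+ 2 * p.1.

(** The phase becomes infinite at the top and bottom sides, so a coefficient depending on it takes
    its limit [l] there. *)
Definition lift (f : R -> R) (l : R) (p : P) := if `|p.2| < 1 then f (phase p) else l.

(* [aff 1 d p.2] adds [d] to the vertical coordinate; this [d] makes the phase grow by [sg]. *)
Definition flow (p : P) : P :=
  let x := aff (lift a 1 p) (lift b 0 p) p.1 in (x, aff 1 (sg / c - c * (x - p.1)) p.2).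

(** The horizontal term of the phase is at most [c ^+ 2] in absolute value, so near the top and
    bottom sides the phase is large uniformly in the horizontal coordinate. *)
Lemma cont_on_lift (f : R -> R) (l : R) : 0 < c -> continuous f -> tends f l ->
  cont_on (@sq R) (lift f l).
Proof.
move=> c0 cf tf p ps; have [p2|p2] := ltP `|p.2| 1.
  have o : open [set q : P | `|q.2| < 1].
    apply: (@open_comp _ _ (fun q : P => `|q.2|) [set r | r < 1]) => [q _|]; last exact: open_lt.
    by move: q; apply: cont_onT; apply: cont_on_norm; exact: cont_on_snd_id.
  apply: (@cont_on_local _ _ (@sq R) [set q : P | `|q.2| < 1]) => //.
    have : nbhs p [set q : P | `|q.2| < 1] by exact: open_nbhs_nbhs.
    by apply: (@filterS _ (nbhs p)) => q.
  apply: (@cont_on_eq _ _ _ (f \o phase)); first by move=> q /= q2; rewrite /lift q2.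
  apply: continuous_comp_cont_on => //.
  apply: cont_onD; last by apply: cont_onM; [exact: cont_on_cst|exact: cont_on_fst_id].
  apply: cont_onM; first exact: cont_on_cst.
  apply: cont_onM; first exact: cont_on_snd_id.
  apply: cont_onV; first by move=> q /= q2; rewrite subr_eq0 gt_eqF.
  by apply: cont_onB; [exact: cont_on_cst|apply: cont_on_norm; exact: cont_on_snd_id].
have -> : lift f l p = l by rewrite /lift ltNge p2.
apply/cvgrPdist_lt => e e0; have [M HM] := tf e e0.
pose K := 1 + `|M| + c ^+ 2.
have K0 : 0 < K by rewrite /K addr_gt0// ?exprn_gt0// ltr_wpDr.
have K1 : M + c ^+ 2 <= K by rewrite /K lerD2r; apply: le_trans (ler_norm _) _; rewrite lerDr.
(* With [q.2] at least 1/2 in absolute value and within [c / (2 * K)] of an end, [c] times the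
   absolute value of [line_of q.2] is at least [K]. This leaves [M] after subtracting the horizontal
   term. *)
pose d := Num.min (1 / 2) (c / (2 * K)).
have d0 : 0 < d by rewrite lt_min !divr_gt0//= mulr_gt0.
have nd : nbhs p (ball p d) by exact: nbhsx_ballx.
apply: (@filterS _ (nbhs p)) nd => q qd qs; rewrite /lift; case: ifPn => q2; last by rewrite subrr normr0.
rewrite distrC; apply: HM.
have q2' : 1 - d < `|q.2|.
  have [_ /=] := qd; rewrite /ball/= => h.
  have := ler_dist_dist p.2 q.2; move=> h2.
  have : `|p.2| - `|q.2| < d by apply: le_lt_trans h; apply: le_trans h2; exact: ler_norm.
  by move: p2; clear; lra.
have dl : d <= 1 / 2 by rewrite ge_min lexx.
have dr : d <= c / (2 * K) by rewrite ge_min lexx orbT.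
have x1 : `|q.1| <= 1 by have [+ _] := qs; rewrite -ler_norml.
have s0 : 0 < 1 - `|q.2| by rewrite subr_gt0.
have H1 : K <= c * `|line_of q.2|.
  rewrite /line_of normrM normfV (gtr0_norm s0) mulrA ler_pdivlMr//.
  have h1 : K * (1 - `|q.2|) <= K * d by rewrite ler_pM2l//; move: q2'; clear; lra.
  have h2 : K * d <= K * (c / (2 * K)) by rewrite ler_pM2l.
  have h3 : K * (c / (2 * K)) = c / 2 by field; rewrite gt_eqF.
  have h4 : c * (1 / 2) <= c * `|q.2| by rewrite ler_pM2l//; move: q2' dl; clear; lra.
  by move: h1 h2 h3 h4; clear; lra.
have H2 : `|c ^+ 2 * q.1| <= c ^+ 2.
  by rewrite normrM gtr0_norm ?exprn_gt0// ler_piMr// exprn_ge0// ltW.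
have := lerB_normD (c * line_of q.2) (c ^+ 2 * q.1).
rewrite -/(phase q) normrM (gtr0_norm c0); move: H1 H2 K1; clear; lra.
Qed.

Hypotheses (c0 : 0 < c) (a0 : forall t, 0 < a t).

Lemma lift_gt0 p : 0 < lift a 1 p.
Proof. by rewrite /lift; case: ifP. Qed.

Lemma sq_norm (p : P) : sq p -> `|p.1| <= 1 /\ `|p.2| <= 1.
Proof. by move=> [p1 p2]; rewrite !ler_norml. Qed.

Lemma cont_flow : continuous a -> continuous b -> tends a 1 -> tends b 0 ->
  cont_on (@sq R) flow.
Proof.
move=> ca cb ta tb.
have cx : cont_on (@sq R) (fun p => aff (lift a 1 p) (lift b 0 p) p.1).
  apply: cont_on_aff; [exact: cont_on_fst_id|exact: cont_on_lift|exact: cont_on_lift| |].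
    by move=> p /sq_norm[].
  by move=> p _; exact: lift_gt0.
apply: cont_on_pair => //; apply: cont_on_aff.
- exact: cont_on_snd_id.
- exact: cont_on_cst.
- apply: cont_onB; first exact: cont_on_cst.
  apply: cont_onM; first exact: cont_on_cst.
  by apply: cont_onB => //; exact: cont_on_fst_id.
- by move=> p /sq_norm[].
- by [].
Qed.

Lemma flow_sq p : sq p -> sq (flow p).
Proof.
move=> /sq_norm[p1 p2]; rewrite sqE /= prod_normE/= ge_max !aff_le1//.
exact: lift_gt0.
Qed.

Lemma flow_osq p : osq p -> osq (flow p).
Proof.
rewrite osqE /= prod_normE gt_max => /andP[p1 p2].
by rewrite prod_normE/= gt_max !aff_lt1//; exact: lift_gt0.
Qed.

Lemma flow_bd p : sq p -> `|p.2| = 1 -> flow p = p.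
Proof.
move=> ps p2; rewrite /flow /lift p2 ltxx aff10 aff_bd//.
by rewrite -surjective_pairing.
Qed.

Lemma line_of_flow2 p : `|p.2| < 1 ->
  line_of (flow p).2 = line_of p.2 + (sg / c - c * ((flow p).1 - p.1)).
Proof. by move=> p2; rewrite /= line_of_aff// mul1r. Qed.

Lemma phase_flow p : `|p.2| < 1 -> phase (flow p) = phase p + sg.
Proof.
move=> p2; rewrite {1}/phase line_of_flow2//.
by rewrite /phase; field; rewrite gt_eqF.
Qed.

Lemma line_of_flow1 p : `|p.1| < 1 -> `|p.2| < 1 ->
  line_of (flow p).1 = a (phase p) * line_of p.1 + b (phase p).
Proof. by move=> p1 p2; rewrite /= line_of_aff// /lift p2. Qed.

End Def.

(** The image has phase [t + sg], where [a'] and [b'] are the coefficients of the inverse affine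
    map. Once the horizontal coordinate is restored, the vertical displacement is the opposite
    one. *)
Lemma flowK (c sg : R) (a b a' b' : R -> R) : 0 < c -> (forall t, 0 < a t) ->
  (forall t, a' (t + sg) = (a t)^-1) -> (forall t, b' (t + sg) = - b t / a t) ->
  forall p, sq p -> flow c (- sg) a' b' (flow c sg a b p) = p.
Proof.
move=> c0 a0 aa bb p ps; have [p1 p2] := sq_norm ps.
have [p2lt|p2ge] := ltP `|p.2| 1; last first.
  have {}p2 : `|p.2| = 1 by apply: le_anti; rewrite p2 p2ge.
  by rewrite (flow_bd _ _ _ _ ps p2) flow_bd.
set q := flow c sg a b p.
have q2 : `|q.2| < 1 by rewrite aff_lt1.
have e1 : (flow c (- sg) a' b' q).1 = p.1.
  rewrite /= /lift q2 phase_flow// aa bb /q /= /lift p2lt affK//.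
rewrite [LHS]surjective_pairing e1.
have -> : (flow c (- sg) a' b' q).2 = aff 1 (- sg / c - c * (p.1 - q.1)) q.2 by rewrite -e1.
have -> : - sg / c - c * (p.1 - q.1) = - (sg / c - c * (q.1 - p.1)) by ring.
by rewrite /q /= aff_comp// mul1r mul1r subrr aff10 -surjective_pairing.
Qed.

End Flow.

(** * Sequences sweeping over an interval *)

Section Omega.
Context {R : realType}.
Local Notation P := (R * R)%type.

(** The orbit is asymptotic to the points [(z n, s)], so it clusters exactly where they do, and
    these return near every point of the segment. *)
Lemma omega_lim_hseg (f : P -> P) (w : P) (z : nat -> R) (al be s : R) :
  (forall n, al <= z n <= be) ->
  (forall e, 0 < e -> exists N, forall n, (N <= n)%N ->
     `|(iter n f w).1 - z n| < e /\ `|(iter n f w).2 - s| < e) ->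
  (forall x e N, al <= x <= be -> 0 < e -> exists2 n, (N <= n)%N & `|z n - x| < e) ->
  omega_lim f w = hseg al be s.
Proof.
move=> zab conv dns; apply/seteqP; split => [[x y] om|[x y] [/= xab ->] U]; last first.
  move=> /nbhs_ballP[e /= e0 eU] N.
  have e20 : 0 < e / 2 by exact: divr_gt0.
  have [N' HN'] := conv _ e20.
  have [n nN nx] := dns x (e / 2) (maxn N N') xab e20.
  have [c1 c2] := HN' n (leq_trans (leq_maxr _ _) nN).
  exists n; split; first exact: leq_trans (leq_maxl _ _) nN.
  apply: eU; split; rewrite /ball/= distrC; last by move: c2 e0; clear; lra.
  have := ler_distD (z n) (iter n f w).1 x.
  by move: c1 nx; clear; lra.
have near_orbit e : 0 < e -> exists n, `|x - z n| < e /\ `|y - s| < e.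
  move=> e0; have e20 : 0 < e / 2 by exact: divr_gt0.
  have [N HN] := conv _ e20.
  have [n [nN [/= nx ny]]] := om (ball (x, y) (e / 2)) (nbhsx_ballx _ _ e20) N.
  rewrite /ball/= in nx ny; have [c1 c2] := HN n nN; exists n.
  have := ler_distD (iter n f w).1 x (z n); have := ler_distD (iter n f w).2 y s.
  by move: nx ny c1 c2; clear; split; lra.
split; last first.
  apply/eqP; rewrite /= -subr_eq0 -normr_le0; apply/ler_addgt0Pl => e e0; rewrite addr0.
  by have [n [_ /ltW]] := near_orbit e e0.
apply/andP; split => /=; apply/ler_addgt0Pl => e e0; have [n [+ _]] := near_orbit e e0;
  have /andP[z1 z2] := zab n; rewrite ltr_norml => /andP[h1 h2]; move: z1 z2 h1 h2; clear; lra.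
Qed.

(* For [2 ^ k <= n + 1 <= 2 ^ k.+1] the sequence descends linearly from 1 to 0 and climbs back. *)
Definition sweep (n : nat) : R := `|n.+1%:R *+ 2 / 2 ^+ trunc_log 2 n.+1 - 3|.

Lemma sweep_bounds n : 0 <= sweep n <= 1.
Proof.
rewrite /sweep normr_ge0/= ler_norml.
have /andP[b1 b2] := @trunc_log_bounds 2 n.+1 isT isT.
set k := trunc_log 2 n.+1 in b1 b2 *.
have p0 : 0 < (2 : R) ^+ k by rewrite exprn_gt0.
have h1 : (2 : R) <= n.+1%:R *+ 2 / 2 ^+ k.
  by rewrite ler_pdivlMr// -natrX -[n.+1%:R *+ 2]mulr_natl -!natrM ler_nat leq_mul2l b1.
have h2 : n.+1%:R *+ 2 / 2 ^+ k <= (4 : R).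
  rewrite ler_pdivrMr// -natrX -[n.+1%:R *+ 2]mulr_natl -!natrM ler_nat.
  by rewrite (_ : 4 = 2 * 2)%N// -mulnA leq_mul2l -expnS ltnW.
by apply/andP; split; lra.
Qed.

(** Within the block of [k] one step changes the value by at most [2 / 2 ^+ k], while
    [n.+2 <= 2 ^ k.+1]. At the passage to the next block the formulas of both blocks give 1. *)
Lemma sweep_step n : n.+2%:R * `|sweep n.+1 - sweep n| <= 4 :> R.
Proof.
have /andP[b1 b2] := @trunc_log_bounds 2 n.+1 isT isT.
set k := trunc_log 2 n.+1 in b1 b2.
have p0 : 0 < (2 : R) ^+ k by rewrite exprn_gt0.
have E : sweep n.+1 = `|n.+2%:R *+ 2 / 2 ^+ k - 3|.
  rewrite /sweep; have [b3|b3] := ltnP n.+2 (2 ^ k.+1).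
    have -> : trunc_log 2 n.+2 = k by apply: trunc_log_eq => //; rewrite b3 (leq_trans b1).
    by [].
  have e : n.+2 = (2 ^ k.+1)%N by apply/eqP; rewrite eqn_leq b3 andbT.
  have -> : trunc_log 2 n.+2 = k.+1 by rewrite e trunc_expnK.
  rewrite e natrX exprS.
  have -> : (2 * 2 ^+ k) *+ 2 / (2 * 2 ^+ k) - 3 = - 1 :> R by field; rewrite gt_eqF.
  have -> : (2 * 2 ^+ k) *+ 2 / 2 ^+ k - 3 = 1 :> R by field; rewrite gt_eqF.
  by rewrite normrN.
rewrite E /sweep -/k.
apply: (@le_trans _ _ (n.+2%:R * (2 / 2 ^+ k))).
  rewrite ler_pM2l ?ltr0n//; apply: le_trans (ler_dist_dist _ _) _.
  have -> : n.+2%:R *+ 2 / 2 ^+ k - 3 - (n.+1%:R *+ 2 / 2 ^+ k - 3) = 2 / 2 ^+ k :> R.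
    by rewrite -[n.+2]addn1 natrD; field; rewrite gt_eqF.
  by rewrite ger0_norm// divr_ge0// ltW.
rewrite mulrA ler_pdivrMr// -natrX -!natrM ler_nat.
by rewrite (_ : 4 = 2 * 2)%N// mulnC -mulnA leq_mul2l -expnS.
Qed.

Lemma sweep_dense (v e : R) (N : nat) : 0 <= v <= 1 -> 0 < e ->
  exists2 n, (N <= n)%N & `|sweep n - v| < e.
Proof.
move=> /andP[v0 v1] e0.
have [m me] : exists m : nat, 2 / e < m%:R.
  exists (Num.truncn (2 / e)).+1.
  by have := truncnS_gt (2 / e).
pose k := (maxn N m).+1.
have km : (m < 2 ^ k)%N by apply: (leq_ltn_trans (leq_maxr N m)); apply: ltnW; exact: ltn_expl.
have kN : (N < 2 ^ k)%N by apply: (leq_ltn_trans (leq_maxl N m)); apply: ltnW; exact: ltn_expl.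
have p0 : 0 < (2 : R) ^+ k by rewrite exprn_gt0.
(* The exact solution for the value [v] on the descending half of block [k]. Rounding it down costs
   at most one step [2 / 2 ^+ k], which is below [e] because [m < 2 ^ k]. The index is [j.-1] since
   [sweep] shifts its argument by one. *)
pose r : R := (3 - v) * 2 ^+ k / 2.
have r0 : 0 <= r by rewrite /r !mulr_ge0 ?invr_ge0 ?exprn_ge0//; lra.
pose j := Num.truncn r.
have /andP[j1 j2] : j%:R <= r < j.+1%:R by exact: truncn_itv.
have rlo : 2 ^+ k <= r by rewrite /r mulrAC ler_peMl ?(ltW p0)//; move: v1; clear; lra.
have jlo : (2 ^ k <= j)%N by rewrite -ltnS -(ltr_nat R) natrX (le_lt_trans rlo).
have jhi : (j < 2 ^ k.+1)%N.
  rewrite -(ltr_nat R) natrX exprS (le_lt_trans j1)// /r mulrAC ltr_pM2r//; lra.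
have jgt : (0 < j)%N by apply: leq_trans jlo; rewrite expn_gt0.
exists j.-1; first by rewrite -ltnS prednK// (leq_trans kN).
rewrite /sweep prednK// (trunc_log_eq _ (_ : 2 ^ k <= j < 2 ^ k.+1)%N)//; last by rewrite jlo jhi.
have h1 : j%:R *+ 2 / 2 ^+ k <= 3 - v.
  rewrite ler_pdivrMr//; move: j1; rewrite /r => j1; move: j1; set q := _ * _ ^+ _; clear; lra.
have h2 : 3 - v < j%:R *+ 2 / 2 ^+ k + e.
  have he : 2 / 2 ^+ k < e.
    rewrite ltr_pdivrMr// mulrC -ltr_pdivrMr//; apply: lt_trans me _.
    by rewrite -natrX ltr_nat.
  apply: (@le_lt_trans _ _ (j%:R *+ 2 / 2 ^+ k + 2 / 2 ^+ k)); last by rewrite ltrD2l.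
  rewrite -mulrDl ler_pdivlMr//; move: j2; rewrite /r -addn1 natrD; set q := (_ * _ ^+ _); clear; lra.
move: h1 h2; set X := (_ *+ 2 / _) => h1 h2.
have X3 : X - 3 <= 0 by move: h1 v0; clear; lra.
rewrite (ler0_norm X3) ltr_norml; apply/andP; split; move: h1 h2 v0 e0; clear; lra.
Qed.

End Omega.

(** * Orbits of the flow map *)

Section Orbit.
Context {R : realType}.
Local Notation P := (R * R)%type.

Lemma of_line_lt (t u : R) : t < u -> of_line t < of_line u.
Proof.
move=> tu; rewrite -subr_gt0 /of_line.
have p0 := onenorm_gt0 t; have q0 := onenorm_gt0 u.
have -> : u / (1 + `|u|) - t / (1 + `|t|) =
  (u - t + (u * `|t| - t * `|u|)) / ((1 + `|t|) * (1 + `|u|)).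
  by field; rewrite !gt_eqF.
apply: divr_gt0; last exact: mulr_gt0.
have [t0|t0] := ger0P t; have [u0|u0] := ger0P u.
- have -> : u - t + (u * t - t * u) = u - t by ring.
  by rewrite subr_gt0.
- by move: (le_lt_trans t0 (lt_trans tu u0)); rewrite ltxx.
- have : t * u <= 0 by rewrite mulr_le0_ge0// ltW.
  by move: tu; clear; nra.
- have -> : u - t + (u * - t - t * - u) = u - t by ring.
  by rewrite subr_gt0.
Qed.

Lemma of_line_le (t u : R) : t <= u -> of_line t <= of_line u.
Proof. by rewrite le_eqVlt => /orP[/eqP->//|/of_line_lt/ltW]. Qed.

Lemma of_line_norm (t : R) : `|of_line t| < 1.
Proof. by rewrite -subr_gt0 of_line_compl invr_gt0 onenorm_gt0. Qed.

Lemma of_line_end (sg t : R) : `|sg| = 1 -> 0 <= sg * t ->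
  `|of_line t - sg| = (1 + sg * t)^-1.
Proof.
move=> s1 st0; have ss : sg * sg = 1 by rewrite -expr2 -real_normK ?num_real// s1 expr1n.
have tn : `|t| = sg * t by rewrite -[RHS]ger0_norm// normrM s1 mul1r.
have d0 : 0 < 1 + sg * t by rewrite ltr_wpDr.
have -> : of_line t - sg = - sg / (1 + sg * t).
  rewrite /of_line tn; apply: (mulIf (lt0r_neq0 d0)); rewrite mulrBl !divfK ?lt0r_neq0//.
  by rewrite mulrDr mulr1 mulrA ss mul1r; ring.
by rewrite normrM normrN s1 mul1r ger0_norm// invr_ge0 ltW.
Qed.

Definition rho (t : R) := 1 + `|t|.
Definition target (A B : R) (n : nat) := A + (B - A) * sweep n.
(** The weight [n.+1] stands for [rho] of the phase after [n] steps, from which it differs by a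
    bounded amount. *)
Definition potential (A B : R) (n : nat) := n.+1%:R * target A B n.

Lemma target_bounds (A B : R) n : A <= B -> A <= target A B n <= B.
Proof.
move=> AB; have /andP[s0 s1] := @sweep_bounds R n; rewrite /target.
have h1 : 0 <= (B - A) * sweep n by rewrite mulr_ge0// subr_ge0.
have h2 : (B - A) * sweep n <= B - A by rewrite ler_piMr// subr_ge0.
by apply/andP; split; move: h1 h2; clear; lra.
Qed.

(** The steps of [sweep] are of order [1 / n], which offsets the weight. Bounded increments are what
    [interpolation] can prescribe. *)
Lemma potential_step (A B : R) n : A <= B ->
  `|potential A B n.+1 - potential A B n| <= `|A| + `|B| + (B - A) * 4.
Proof.
move=> AB; have -> : potential A B n.+1 - potential A B n =
    target A B n + (B - A) * (n.+2%:R * (sweep n.+1 - sweep n)).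
  by rewrite /potential /target -[n.+2]addn1 natrD; ring.
apply: le_trans (ler_normD _ _) _; apply: lerD.
  have /andP[h1 h2] := target_bounds n AB; rewrite ler_norml.
  have := ler_norm B; have := ler_norm (- A); rewrite normrN.
  have := normr_ge0 A; have := normr_ge0 B.
  by move: h1 h2; clear; move=> *; apply/andP; split; lra.
rewrite normrM ger0_norm ?subr_ge0// ler_wpM2l ?subr_ge0//.
by rewrite normrM ger0_norm//; exact: sweep_step.
Qed.

(* [rho] of the phase times the horizontal coordinate gains [h] of the phase at each
   step, so it equals [potential] up to a constant, and dividing by [rho] leaves [target]. *)
Lemma flow_omega (c sg : R) (h : R -> R) (A B : R) (J : nat) (p : P) :
  0 < c -> `|sg| = 1 -> A <= B -> osq p ->
  (forall n, (J <= n)%N ->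
     h (phase c p + n%:R * sg) = potential A B n.+1 - potential A B n) ->
  omega_lim (flow c sg (fun t => rho t / rho (t + sg)) (fun t => h t / rho (t + sg))) p
  = hseg (of_line A) (of_line B) sg.
Proof.
move=> c0 s1 AB po hJ; set F := flow _ _ _ _.
have ss : sg * sg = 1 by rewrite -expr2 -real_normK ?num_real// s1 expr1n.
have r0 t : 0 < rho t by exact: onenorm_gt0.
have a0 (t : R) : 0 < rho t / rho (t + sg) by exact: divr_gt0.
pose q n := iter n F p.
have qo n : osq (q n) by elim: n => // n IH; apply: flow_osq.
have qn n : `|(q n).1| < 1 /\ `|(q n).2| < 1.
  by have := qo n; rewrite osqE /= prod_normE gt_max => /andP.
pose tau := phase c p.
have qt n : phase c (q n) = tau + n%:R * sg.
  elim: n => [|n IH]; first by rewrite mul0r addr0.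
  have [_ q2] := qn n.
  by rewrite /q iterS phase_flow// IH -[n.+1]addn1 natrD mulrDl mul1r addrA.
pose u n := rho (tau + n%:R * sg) * line_of (q n).1.
have uS n : u n.+1 = u n + h (tau + n%:R * sg).
  have [q1 q2] := qn n.
  have e : tau + n.+1%:R * sg = tau + n%:R * sg + sg by rewrite -[n.+1]addn1 natrD mulrDl mul1r addrA.
  rewrite /u e; have -> : line_of (q n.+1).1 =
    rho (tau + n%:R * sg) / rho (tau + n%:R * sg + sg) * line_of (q n).1
      + h (tau + n%:R * sg) / rho (tau + n%:R * sg + sg).
    by rewrite {1}/q iterS line_of_flow1// qt.
  by field; rewrite gt_eqF.
pose C := u J - potential A B J.
have uE n : (J <= n)%N -> u n = potential A B n + C.
  elim: n => [|n IH]; first by rewrite leqn0 => /eqP J0; rewrite /C J0 addrC subrK.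
  rewrite leq_eqVlt => /orP[/eqP <-|]; first by rewrite /C addrC subrK.
  rewrite ltnS => Jn; rewrite uS IH// hJ//; ring.
(* Numerator of the error: the constant [C], then a bound for [target] times the discrepancy between
   [n.+1] and [rho]; the final 1 makes it positive. *)
pose K := `|C| + (`|A| + `|B|) * `|tau| + 1.
have K0 : 0 < K by rewrite /K ltr_wpDl// addr_ge0// mulr_ge0// addr_ge0.
have rlo n : n.+1%:R - `|tau| <= rho (tau + n%:R * sg).
  have := lerB_normD (n%:R * sg) tau; rewrite normrM s1 mulr1 normr_nat addrC /rho.
  by rewrite -[n.+1]addn1 natrD [tau + _]addrC; clear; lra.
have rd n : `|n.+1%:R - rho (tau + n%:R * sg)| <= `|tau|.
  have e1 : `|n%:R * sg| = n%:R :> R by rewrite normrM s1 mulr1 normr_nat.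
  have := ler_dist_dist (n%:R * sg) (tau + n%:R * sg).
  rewrite e1 opprD addrCA subrr addr0 normrN; congr (`|_| <= _).
  by rewrite /rho -[n.+1]addn1 natrD; ring.
have x_err n : (J <= n)%N -> `|line_of (q n).1 - target A B n| <= K / rho (tau + n%:R * sg).
  move=> Jn; have -> : line_of (q n).1 - target A B n =
     (C + target A B n * (n.+1%:R - rho (tau + n%:R * sg))) / rho (tau + n%:R * sg).
    have -> : line_of (q n).1 = u n / rho (tau + n%:R * sg).
      by rewrite /u mulrAC divff ?mul1r// gt_eqF.
    by rewrite uE// /potential; field; rewrite gt_eqF.
  rewrite normrM normfV [`|rho _|]gtr0_norm// ler_pM2r ?invr_gt0//.
  apply: le_trans (ler_normD _ _) _; rewrite /K -[leRHS]addrA lerD2l; apply: ler_wpDr => //.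
  rewrite normrM ler_pM//.
  have /andP[h1 h2] := target_bounds n AB; rewrite ler_norml.
  have := ler_norm B; have := ler_norm (- A); rewrite normrN.
  have := normr_ge0 A; have := normr_ge0 B.
  by move: h1 h2; clear; move=> *; apply/andP; split; lra.
have small e : 0 < e -> exists N, forall n, (N <= n)%N -> K / rho (tau + n%:R * sg) < e.
  move=> e0; exists (Num.truncn (K / e + `|tau|)).+1 => n Nn.
  rewrite ltr_pdivrMr// mulrC -ltr_pdivrMr//; apply: lt_le_trans (rlo n).
  rewrite ltrBrDr; apply: lt_le_trans (truncnS_gt _) _.
  by rewrite ler_nat; apply: leq_trans Nn _.
apply: (@omega_lim_hseg _ _ _ (fun n => of_line (target A B n))).
- by move=> n; have /andP[h1 h2] := target_bounds n AB; rewrite !of_line_le.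
- move=> e e0; have [N1 HN1] := small e e0.
  (* From [N2] on, the vertical coordinate on the line exceeds [e^-1] in the direction [sg]: the
     phase has moved [n] steps and its horizontal term is at most [c ^+ 2]. *)
  pose N2 := (Num.truncn (c * e^-1 + `|tau| + c ^+ 2)).+1.
  exists (maxn J (maxn N1 N2)) => n; rewrite !geq_max => /and3P[nJ n1 n2].
  have [q1 q2] := qn n; split.
    rewrite -/(q n) -[(q n).1]line_ofK//; apply: le_lt_trans (of_line_lip _ _) _.
    by apply: le_lt_trans (x_err _ nJ) _; exact: HN1.
  rewrite -/(q n) -[(q n).2]line_ofK//.
  have yt : line_of (q n).2 = (tau + n%:R * sg - c ^+ 2 * (q n).1) / c.
    by rewrite -qt /phase addrK mulrC mulKf// gt_eqF.
  have n2' : c * e^-1 + `|tau| + c ^+ 2 < n%:R.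
    by apply: lt_le_trans (truncnS_gt _) _; rewrite ler_nat.
  have big : e^-1 < sg * line_of (q n).2.
    rewrite yt mulrA ltr_pdivlMr// mulrBr mulrDr mulrCA ss mulr1.
    have h1 : - `|tau| <= sg * tau.
      by rewrite lerNl -mulrN; apply: le_trans (ler_norm _) _; rewrite normrM s1 mul1r normrN.
    have h2 : sg * (c ^+ 2 * (q n).1) <= c ^+ 2.
      apply: le_trans (ler_norm _) _; rewrite normrM s1 mul1r normrM gtr0_norm ?exprn_gt0//.
      by rewrite ler_piMr ?ltW// exprn_gt0.
    by rewrite mulrC; move: n2' h1 h2; clear; lra.
  have e0' : 0 < e^-1 by rewrite invr_gt0.
  rewrite of_line_end//; last by rewrite ltW// (lt_trans e0').
  rewrite -[ltRHS]invrK ltf_pV2 ?posrE//.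
    by move: big; clear; lra.
  by move: big e0'; clear; lra.
- move=> x e N /andP[x1 x2] e0.
  have xlt : `|x| < 1.
    have := of_line_norm A; have := of_line_norm B; rewrite !ltr_norml.
    by move: x1 x2; clear; move=> ? ? /andP[? ?] /andP[? ?]; apply/andP; split; lra.
  pose w := line_of x; have xw : x = of_line w by rewrite line_ofK.
  have Aw : A <= w by rewrite leNgt; apply/negP => /of_line_lt; rewrite -xw ltNge x1.
  have wB : w <= B by rewrite leNgt; apply/negP => /of_line_lt; rewrite -xw ltNge x2.
  have [AB'|AB'] := eqVneq A B.
    exists N => //; suff -> : of_line (target A B N) = x by rewrite subrr normr0.
    by rewrite xw /target AB' subrr mul0r addr0; congr of_line; apply: le_anti; rewrite wB -AB' Aw.
  have BA0 : 0 < B - A by rewrite subr_gt0 lt_def eq_sym AB'.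
  have [||n nN hn] := @sweep_dense _ ((w - A) / (B - A)) (e / (B - A)) N.
  + by rewrite divr_ge0 ?subr_ge0//= ler_pdivrMr// mul1r lerB.
  + exact: divr_gt0.
  exists n => //; rewrite xw; apply: le_lt_trans (of_line_lip _ _) _.
  have -> : target A B n - w = (B - A) * (sweep n - (w - A) / (B - A)).
    by rewrite /target; field; rewrite gt_eqF.
  by rewrite normrM gtr0_norm// mulrC -ltr_pdivlMr.
Qed.

End Orbit.

(** * Generic phases and interpolation on them *)

Section Interp.
Context {R : realType}.
Local Notation P := (R * R)%type.

Lemma countable_subset (T : Type) (A B : set T) : A `<=` B -> countable B -> countable A.
Proof. by move=> /subset_card_le; exact: sub_countable. Qed.

Lemma quadratic_roots_countable (a b m : R) : (a != 0) || (b != 0) ->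
  countable [set c : R | c * a + c ^+ 2 * b = m].
Proof.
move=> ab; have [b0|b0] := eqVneq b 0.
  have a0 : a != 0 by move: ab; rewrite b0 eqxx orbF.
  apply: (@countable_subset _ _ [set m / a]); last exact: countable1.
  by move=> c /=; rewrite b0 mulr0 addr0 => <-; rewrite mulfK.
have [[c0 /= c0E]|nc] := pselect ([set c : R | c * a + c ^+ 2 * b = m] !=set0); last first.
  apply: (@countable_subset _ _ set0); last exact: countable0.
  by move=> c cE; apply: nc; exists c.
(* The second root is given by Vieta's formula. *)
apply: (@countable_subset _ _ [set c0; - a / b - c0]); last first.
  by apply: finite_set_countable; exact: finite_set2.
move=> c /= cE; have : (c - c0) * (a + b * (c + c0)) = 0.
  transitivity ((c * a + c ^+ 2 * b) - (c0 * a + c0 ^+ 2 * b)); first by ring.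
  by rewrite cE c0E subrr.
move=> /eqP; rewrite mulf_eq0 => /orP[/eqP h|/eqP h]; [left|right].
  by apply/eqP; rewrite -subr_eq0; apply/eqP.
have h' : b * (c + c0) = - a by apply/eqP; rewrite -addr_eq0 addrC; apply/eqP.
by apply: (mulfI b0); rewrite mulrBr mulrCA divff// mulr1 -h'; ring.
Qed.

(** Countable sets are Lebesgue null, whereas the interval from 1 to 2 has measure 1. *)
Lemma countable_avoid (B : set R) : countable B -> exists2 c, 1 <= c & ~ B c.
Proof.
move=> cB; apply: contrapT => h.
have IB : `[(1 : R), 2]%classic `<=` B.
  move=> c /=; rewrite in_itv/= => /andP[c1 _]; apply: contrapT => nB.
  by apply: h; exists c.
have := countable_lebesgue_measure0 (countable_subset IB cB).
rewrite lebesgue_measure_itv/= lte_fin ltr1n /= -EFinB => /eqP.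
by rewrite eqe subr_eq0 => /eqP h2; move: (ltr1n R 2); rewrite h2 ltxx.
Qed.

Lemma line_of_inj (x y : R) : `|x| < 1 -> `|y| < 1 -> line_of x = line_of y -> x = y.
Proof. by move=> x1 y1 e; rewrite -(line_ofK x1) -(line_ofK y1) e. Qed.

(** Two distinct points and an integer exclude only the roots [c] of one nontrivial quadratic
    equation, and there are countably many such triples. *)
Lemma generic_phase (V : set P) : countable V -> V `<=` @osq R ->
  exists2 c, 0 < c & forall v v', V v -> V v' -> v <> v' ->
    forall m : int, phase c v - phase c v' <> m%:~R.
Proof.
move=> cV Vo.
pose bad (z : (P * P) * int) := [set c : R |
  c * (line_of z.1.1.2 - line_of z.1.2.2) + c ^+ 2 * (z.1.1.1 - z.1.2.1) = z.2%:~R].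
pose I := [set z : (P * P) * int | V z.1.1 /\ V z.1.2 /\ z.1.1 <> z.1.2].
have cI : countable I.
  apply: (@countable_subset _ _ ((V `*` V) `*` setT)); first by move=> z [? []].
  by apply: countableX; [exact: countableX|exact: countableP].
have [c c1 nB] : exists2 c, 1 <= c & ~ (\bigcup_(z in I) bad z) c.
  apply: countable_avoid; apply: bigcup_countable => // -[[v v'] m] [/= Vv [Vv' vv']].
  apply: quadratic_roots_countable; rewrite -negb_and; apply/negP => /andP[].
  rewrite !subr_eq0 => /eqP e2 /eqP e1; apply: vv'.
  have := Vo _ Vv; have := Vo _ Vv'; rewrite osqE /= !prod_normE/= !gt_max.
  move=> /andP[_ h2] /andP[_ h1].
  by rewrite [v]surjective_pairing [v']surjective_pairing e1 (line_of_inj h1 h2 e2).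
exists c; first exact: lt_le_trans c1.
move=> v v' Vv Vv' vv' m e; apply: nB; exists (v, v', m) => //=.
by rewrite /bad/= -e /phase; ring.
Qed.

Lemma finite_int_ball (K : nat) : finite_set [set m : int | (absz m <= K)%N].
Proof.
apply: (@sub_finite_set _ _ ((fun n : nat => n%:Z) @` `I_K.+1 `|` (fun n : nat => - n%:Z) @` `I_K.+1)).
  move=> [m|m] /= mK; [left|right]; first by exists m.
  by exists m.+1 => //; rewrite NegzE.
by rewrite finite_setU; split; apply: finite_image; exact: finite_II.
Qed.

(** The far phases form a closed discrete set, on which every function is continuous. Divided by the
    square root of [rho] the data is bounded by 1, and Tietze's theorem extends it with the same
    bound. *)
Lemma interpolation (V : set P) (tau : P -> R) (D : P -> int -> R) (C : P -> R) :
  countable V ->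
  (forall v v', V v -> V v' -> v <> v' -> forall m : int, tau v - tau v' <> m%:~R) ->
  (forall v m, V v -> `|D v m| <= C v) ->
  exists g : R -> R, continuous g /\ (forall t, g t ^+ 2 <= rho t) /\
    forall v, V v -> exists J, forall m : int, (J <= absz m)%N -> g (tau v + m%:~R) = D v m.
Proof.
move=> /countable_injP [j jinj] tauN DC.
(* The threshold grows with the rank [j v], so that only finitely many [v] have far phases in a
   given bounded set; it also makes [C v ^+ 2 <= rho] at these phases. *)
pose J v := (j v + Num.truncn (`|tau v| + C v ^+ 2)).+1.
have Jlo v : (j v)%:R + `|tau v| + C v ^+ 2 <= (J v)%:R.
  rewrite /J -addnS natrD -addrA lerD2l; apply/ltW; exact: truncnS_gt.
have tlo v (m : int) : (J v <= absz m)%N -> (j v)%:R + C v ^+ 2 <= `|tau v + m%:~R|.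
  move=> Jm; have h1 : (J v)%:R <= `|m%:~R : R| by rewrite -intr_norm -abszE pmulrn ler_nat.
  have := lerB_normD (m%:~R) (tau v); rewrite [_ + tau v]addrC; move: (Jlo v) h1; clear; lra.
pose S : set R := [set t | exists v m, [/\ V v, (J v <= absz m)%N & t = tau v + m%:~R]].
pose w i := xget (0 : P) [set v | V v /\ j v = i].
have wj v : V v -> w (j v) = v.
  move=> Vv; have [Vw jw] : [set v' | V v' /\ j v' = j v] (w (j v)) by apply: xgetPex; exists v.
  by apply: jinj => //; exact/mem_set.
have Sfin N : finite_set (S `&` [set t | `|t| <= N%:R]).
  apply: (@sub_finite_set _ _ (\bigcup_(i in `I_N.+1)
     ((fun m : int => tau (w i) + m%:~R) @`
       [set m | (absz m <= (Num.truncn (N%:R + `|tau (w i)|)).+1)%N]))); last first.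
    apply: bigcup_finite; first exact: finite_II.
    by move=> i _; apply: finite_image; exact: finite_int_ball.
  move=> t [[v [m [Vv Jm ->]]] /= tN]; exists (j v) => /=.
    have := tlo _ _ Jm; have := sqr_ge0 (C v) => h1 h2.
    by rewrite ltnS -(ler_nat R); move: h1 h2 tN; clear; lra.
  rewrite wj//; exists m => //=.
  rewrite -(ler_nat R); apply: (@le_trans _ _ (N%:R + `|tau v|)); last first.
    by apply/ltW; exact: truncnS_gt.
  have -> : (absz m)%:R = `|m%:~R : R| by rewrite -intr_norm -abszE pmulrn.
  by have := lerB_normD (m%:~R) (tau v); rewrite [_ + tau v]addrC; move: tN; clear; lra.
have Sdisc x : nbhs x (fun y => S y -> y = x).
  pose N := (Num.truncn (`|x| + 1)).+1.
  have cF : closed ((S `&` [set t | `|t| <= N%:R]) `\ x).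
    apply: (iffLR accessible_finite_set_closed).
      by apply: hausdorff_accessible; exact: Rhausdorff.
    by apply: finite_setD; exact: Sfin.
  have n1 : nbhs x (~` ((S `&` [set t | `|t| <= N%:R]) `\ x)).
    by apply: open_nbhs_nbhs; split; [exact: closed_openC|move=> [_]; apply].
  have n2 : nbhs x (ball x 1) by exact: nbhsx_ballx.
  apply: filterS2 n1 n2 => y h1; rewrite /ball/= => h2 Sy; apply: contrapT => yx.
  apply: h1; split => //; split => //=.
  have h3 : `|x| + 1 < N%:R by exact: truncnS_gt.
  by have := lerB_dist y x; rewrite distrC; move: h2 h3; clear; lra.
have clS : closed S.
  rewrite -[S]setCK; apply: open_closedC; rewrite openE => x nSx.
  by apply: filterS (Sdisc x) => y h Sy; apply: nSx; rewrite -(h Sy).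
(* Single-valued on [S] because distinct points of [V] have phases distinct modulo 1. *)
pose f t := xget (0 : R) [set r | exists v m, [/\ V v, (J v <= absz m)%N, t = tau v + m%:~R
   & r = D v m / Num.sqrt (rho t)]].
have fE v m : V v -> (J v <= absz m)%N ->
    f (tau v + m%:~R) = D v m / Num.sqrt (rho (tau v + m%:~R)).
  move=> Vv Jm; rewrite /f; apply: xget_unique; first by exists v, m.
  move=> _ [v' [m' [Vv' Jm' e ->]]].
  have vv' : v = v'.
    apply: contrapT => vv'; apply: (tauN _ _ Vv Vv' vv' (m' - m)).
    by rewrite intrB; move: e; clear; lra.
  have mm' : m = m'.
    by move: e; rewrite vv' => /addrI /intr_inj.
  by rewrite vv' mm'.
have rho1 (t : R) : 1 <= rho t by rewrite /rho lerDl.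
have rho0 (t : R) : 0 < rho t by exact: onenorm_gt0.
have cf : {within S, continuous (f : R -> R^o)}.
  apply/cont_onP => x Sx W Wx; apply: filterS (Sdisc x) => y h Sy /=.
  by rewrite (h Sy); exact: nbhs_singleton.
have fle x : S x -> `|f x| <= 1.
  move=> [v [m [Vv Jm ->]]]; rewrite fE// normrM normfV [`|Num.sqrt _|]ger0_norm ?sqrtr_ge0//.
  rewrite ler_pdivrMr ?sqrtr_gt0// mul1r; apply: le_trans (DC v m Vv) _.
  apply: le_trans (ler_norm _) _; rewrite -sqrtr_sqr ler_wsqrtr//.
  have := tlo _ _ Jm; have : 0 <= (j v)%:R :> R by [].
  by rewrite /rho; clear; lra.
have [e [fe ce e1]] := continuous_bounded_extension (@pseudometric_normal R R) clS ltr01 cf fle.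
exists (fun t => Num.sqrt (rho t) * e t); split; [|split].
- apply: cont_onT; apply: cont_onM.
    apply: cont_on_sqrt; apply: cont_onD; first exact: cont_on_cst.
    by apply: cont_on_norm; exact: cont_on_id.
  exact: continuous_cont_on.
- move=> t; rewrite exprMn sqr_sqrtr ?(ltW (rho0 t))// ler_piMr ?(ltW (rho0 t))//.
  by rewrite -real_normK ?num_real// expr_le1.
- move=> v Vv; exists (J v) => m Jm; rewrite -fe; last by apply/mem_set; exists v, m.
  by rewrite fE// mulrCA divff ?mulr1// gt_eqF// sqrtr_gt0.
Qed.

End Interp.

(** * Continuity of the rates, and the homeomorphism with prescribed limits *)

Section Core.
Context {R : realType}.
Local Notation P := (R * R)%type.

Section Rates.
Variable sg : R.
Hypothesis s1 : `|sg| = 1.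

Lemma rho_gt0 (t : R) : 0 < rho t. Proof. exact: onenorm_gt0. Qed.

Lemma rho_shift (t : R) : `|t| <= rho (t + sg).
Proof.
by have := lerB_normD t sg; rewrite s1 /rho; clear; lra.
Qed.

Lemma continuous_rho_shift : continuous (fun t : R => rho (t + sg)).
Proof.
apply: cont_onT; apply: cont_onD; first exact: cont_on_cst.
by apply: cont_on_norm; apply: cont_onD; [exact: cont_on_id|exact: cont_on_cst].
Qed.

Lemma continuous_rate (h : R -> R) : continuous h -> continuous (fun t => h t / rho (t + sg)).
Proof.
move=> ch; apply: cont_onT; apply: cont_onM; first exact: continuous_cont_on.
apply: cont_onV; first by move=> t _; rewrite gt_eqF// rho_gt0.
by apply: continuous_cont_on; exact: continuous_rho_shift.
Qed.

Lemma tends_slope : tends (fun t : R => rho t / rho (t + sg)) 1.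
Proof.
move=> e e0; exists (e^-1 + 1) => t te.
have t0 : 0 < `|t| by apply: lt_le_trans te; rewrite addr_gt0// invr_gt0.
have r0 := rho_gt0 (t + sg).
have -> : rho t / rho (t + sg) - 1 = (`|t| - `|t + sg|) / rho (t + sg).
  by rewrite /rho; field; rewrite gt_eqF// rho_gt0.
rewrite normrM normfV [`|rho _|]gtr0_norm// ltr_pdivrMr//.
have h1 : `| `|t| - `|t + sg| | <= 1.
  by apply: le_trans (ler_dist_dist _ _) _; rewrite opprD addrA subrr sub0r normrN s1.
apply: (le_lt_trans h1); apply: (@lt_le_trans _ _ (e * `|t|)); last first.
  by rewrite ler_pM2l//; exact: rho_shift.
rewrite mulrC -ltr_pdivrMr// div1r; apply: lt_le_trans te.
by rewrite ltrDl.
Qed.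

(** [h] is of the order of the square root of [rho], hence negligible against the shifted [rho]. *)
Lemma tends_rate (h : R -> R) : (forall t, h t ^+ 2 <= 2 * rho t) ->
  tends (fun t => h t / rho (t + sg)) 0.
Proof.
move=> hr e e0; exists (4 / e ^+ 2 + 1) => t te; rewrite subr0.
have e20 : 0 < e ^+ 2 by rewrite exprn_gt0.
have t1 : 1 <= `|t|.
  by apply: le_trans te; rewrite lerDr divr_ge0// ltW.
have t0 : 0 < `|t| by exact: lt_le_trans t1.
have r0 := rho_gt0 (t + sg).
rewrite normrM normfV [`|rho _|]gtr0_norm// ltr_pdivrMr//.
apply: (@lt_le_trans _ _ (e * `|t|)); last by rewrite ler_pM2l//; exact: rho_shift.
rewrite -(@ltr_pXn2r _ 2)// ?nnegrE ?mulr_ge0 ?(ltW e0)// exprMn real_normK ?num_real//.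
apply: le_lt_trans (hr t) _.
apply: (@le_lt_trans _ _ (4 * `|t|)); first by move: t1; rewrite /rho; clear; lra.
rewrite [`|t| ^+ 2]expr2 mulrA ltr_pM2r// mulrC -ltr_pdivrMr//.
by apply: lt_le_trans te; rewrite ltrDl.
Qed.
End Rates.

Lemma line_of_le (x y : R) : `|x| < 1 -> `|y| < 1 -> x <= y -> line_of x <= line_of y.
Proof.
move=> x1 y1 xy; rewrite leNgt; apply/negP => /of_line_lt.
by rewrite !line_ofK// ltNge xy.
Qed.

(** One function [g] serves both time directions: its values at [phase c v + m] steer the forward
    orbit for [m >= 0] and the backward orbit for [m < 0]. *)
Theorem homeo_prescribed_limits (V : set P) (al1 be1 al2 be2 : P -> R) :
  countable V -> V `<=` @osq R ->
  (forall v, V v -> -1 < al1 v /\ al1 v <= be1 v /\ be1 v < 1) ->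
  (forall v, V v -> -1 < al2 v /\ al2 v <= be2 v /\ be2 v < 1) ->
  exists Phi Psi : P -> P, homeo_pair (@sq R) (@sq R) Phi Psi /\
    (forall p, sq p -> `|p.2| = 1 -> Phi p = p) /\
    (forall v, V v -> omega_lim Phi v = hseg (al1 v) (be1 v) 1 /\
                      omega_lim Psi v = hseg (al2 v) (be2 v) (-1)).
Proof.
move=> cV Vo H1 H2; have [c c0 cN] := generic_phase cV Vo.
pose Q1 v := potential (line_of (al1 v)) (line_of (be1 v)).
pose Q2 v := potential (line_of (al2 v)) (line_of (be2 v)).
(* [Negz n] is [- (n + 1)] and carries the increment of backward step [n], with the sign and shift
   that [h] undoes. *)
pose D (v : P) (m : int) := match m with
  | Posz n => Q1 v n.+1 - Q1 v n
  | Negz n => - (Q2 v n.+1 - Q2 v n) end.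
pose K (a b : R) := `|a| + `|b| + (b - a) * 4.
pose C v := K (line_of (al1 v)) (line_of (be1 v)) + K (line_of (al2 v)) (line_of (be2 v)).
have itv (a b : R) : -1 < a /\ a <= b /\ b < 1 -> `|a| < 1 /\ `|b| < 1 /\ line_of a <= line_of b.
  move=> [a1 [ab b1]]; have h1 : `|a| < 1 by rewrite ltr_norml a1 (le_lt_trans ab).
  have h2 : `|b| < 1 by rewrite ltr_norml b1 (lt_le_trans a1).
  by split => //; split => //; exact: line_of_le.
have K0 (a b : R) : a <= b -> 0 <= K a b.
  by move=> ab; rewrite /K !addr_ge0// mulr_ge0// subr_ge0.
have DC v m : V v -> `|D v m| <= C v.
  move=> Vv; have [_ [_ l1]] := itv _ _ (H1 v Vv); have [_ [_ l2]] := itv _ _ (H2 v Vv).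
  case: m => n; rewrite /D /C.
    by apply: ler_wpDr; [exact: K0|exact: potential_step].
  by rewrite normrN; apply: ler_wpDl; [exact: K0|exact: potential_step].
have [g [cg [gr gD]]] := interpolation cV cN DC.
(* Forced by [flowK]: undoing the step from phase [t - 1] to phase [t] subtracts [g (t - 1)]. *)
pose h (t : R) := - g (t - 1).
have ch : continuous h.
  apply: cont_onT; apply: cont_onN; apply: continuous_comp_cont_on => //.
  by apply: cont_onB; [exact: cont_on_id|exact: cont_on_cst].
have hr t : h t ^+ 2 <= 2 * rho t.
  rewrite /h sqrrN; apply: le_trans (gr _) _.
  by have := ler_normB t 1; rewrite normr1 /rho; have := normr_ge0 t; clear; lra.
have gr' t : g t ^+ 2 <= 2 * rho t.
  by apply: le_trans (gr _) _; have := rho_gt0 t; clear; lra.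
have n1 : `|1 : R| = 1 by rewrite normr1.
have n1' : `|-1 : R| = 1 by rewrite normrN1.
pose fl (sg : R) (u : R -> R) := flow c sg (fun t => rho t / rho (t + sg)) (fun t => u t / rho (t + sg)).
have crho : continuous (rho : R -> R).
  apply: cont_onT; apply: cont_onD; first exact: cont_on_cst.
  by apply: cont_on_norm; exact: cont_on_id.
have sl0 (sg t : R) : 0 < rho t / rho (t + sg) by rewrite divr_gt0// rho_gt0.
have cfl (sg : R) (u : R -> R) : `|sg| = 1 -> continuous u -> (forall t, u t ^+ 2 <= 2 * rho t) ->
    cont_on (@sq R) (fl sg u).
  move=> s1 cu ur; apply: cont_flow => //.
  - exact: continuous_rate.
  - exact: continuous_rate.
  - exact: tends_slope.
  - exact: tends_rate.
exists (fl 1 g), (fl (-1) h); split; [|split].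
- split; [exact/cont_onP/cfl|split; [exact/cont_onP/cfl|]].
  split; first by move=> p; exact: flow_sq.
  split; first by move=> p; exact: flow_sq.
  split=> p ps.
    apply: flowK => // t; first by rewrite addrK invf_div.
    by rewrite /h addrK; field; rewrite !gt_eqF// rho_gt0.
  rewrite /fl -{1}[1]opprK; apply: flowK => // t; first by rewrite subrK invf_div.
  by rewrite /h subrK; field; rewrite !gt_eqF// rho_gt0.
- by move=> p ps p2; exact: flow_bd.
- move=> v Vv; have [J HJ] := gD v Vv.
  have [a1 [b1 l1]] := itv _ _ (H1 v Vv); have [a2 [b2 l2]] := itv _ _ (H2 v Vv).
  rewrite -[in hseg (al1 v)](line_ofK a1) -[in hseg _ (be1 v)](line_ofK b1).
  rewrite -[in hseg (al2 v)](line_ofK a2) -[in hseg _ (be2 v)](line_ofK b2).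
  split; apply: (@flow_omega _ _ _ _ _ _ J) => //; try exact: Vo.
  + by move=> n Jn; rewrite mulr1 (HJ (Posz n)).
  + move=> n Jn; rewrite /h mulrN1 -addrA -opprD.
    have -> : - (n%:R + 1) = (Negz n)%:~R :> R by rewrite NegzE mulrNz natr1.
    by rewrite (HJ (Negz n)) ?opprK//=; apply: leq_trans Jn _.
Qed.

End Core.

(** * Assembling the openings *)

Section Xi.
Context {R : realType}.
Local Notation P := (R * R)%type.
Variables (s : nat -> R) (X D Z : nat -> set P) (e : nat -> P -> P) (al be : nat -> R).
Hypothesis s1 : forall k, `|s k| = 1.
Hypothesis op : forall k, opening (s k) (X k) (D k) (Z k) (e k) (al k) (be k).
Hypothesis disj : forall k m p, D k p -> D m p -> k = m.
Hypothesis small : forall ep : R, 0 < ep -> exists N, forall k, (N <= k)%N ->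
  forall p q, D k p -> D k q -> `|p - q| < ep.

(** Off all hutches the set is empty, and the default value [p] makes this the identity. *)
Definition xi (p : P) : P := xget p [set q | exists2 k, D k p & q = e k p].

Lemma xi_in k p : D k p -> xi p = e k p.
Proof.
move=> Dp; rewrite /xi; apply: xget_unique; first by exists k.
by move=> _ [m Dm ->]; rewrite (disj Dp Dm).
Qed.

Lemma xi_out p : (forall k, ~ D k p) -> xi p = p.
Proof.
by move=> nD; rewrite /xi xgetPN// => q [k Dk _]; apply: (nD k).
Qed.

Lemma in_or_out p : (exists k, D k p) \/ (forall k, ~ D k p).
Proof.
have [h|h] := pselect (exists k, D k p); [by left|right => k Dk; apply: h; by exists k].
Qed.

(* Each [e m] preserves [D m], and [e k] is the identity there for [k != m]. *)
Fixpoint xin n (p : P) : P := if n is m.+1 then xin m (e m p) else p.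

Lemma e_sq k p : sq p -> sq (e k p).
Proof.
move=> ps; have [Dp|nDp] := pselect (D k p); last by rewrite (opening_out (op k)).
exact/(opening_dsq (op k))/(opening_in (op k)).
Qed.

Lemma cont_xin n : cont_on (@sq R) (xin n).
Proof.
elim: n => [|n IH]; first exact: cont_on_id.
apply: (cont_on_comp (f := e n) _ IH); first exact: opening_cont (op n).
by move=> p; exact: e_sq.
Qed.

Lemma xin_out n p : (forall k, (k < n)%N -> ~ D k p) -> xin n p = p.
Proof.
elim: n => //= n IH h; rewrite (opening_out (op n)); last exact: h.
by apply: IH => k kn; apply: h; rewrite ltnS ltnW.
Qed.

Lemma xin_in n k p : (k < n)%N -> D k p -> xin n p = e k p.
Proof.
elim: n => //= n IH; rewrite ltnS leq_eqVlt => /orP[/eqP -> Dn|kn Dk].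
  apply: xin_out => m mn Dm; have := disj Dm (opening_in (op n) Dn) => mE.
  by rewrite mE ltnn in mn.
rewrite (opening_out (op n)) ?IH// => Dn.
by rewrite (disj Dn Dk) ltnn in kn.
Qed.

Lemma xi_sq p : sq p -> sq (xi p).
Proof.
move=> ps; have [[k Dk]|nD] := in_or_out p; last by rewrite xi_out.
by rewrite (xi_in Dk); exact: e_sq.
Qed.

(** [xi] is the uniform limit of the continuous maps [xin N]: the two can differ only on hutches of
    index at least [N], which both preserve and which are small. *)
Lemma cont_xi : cont_on (@sq R) xi.
Proof.
move=> p ps; apply/cvgrPdist_lt => ep ep0.
have e3 : 0 < ep / 3 by exact: divr_gt0.
have [N HN] := small e3.
have close q : `|xi q - xin N q| < ep / 3.
  have [[k Dk]|nD] := in_or_out q; last by rewrite xi_out// xin_out ?subrr ?normr0.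
  rewrite (xi_in Dk); have [kN|Nk] := ltnP k N; first by rewrite (xin_in kN Dk) subrr normr0.
  rewrite xin_out; first by apply: (HN k) => //; exact: opening_in (op k) _ Dk.
  by move=> m mN Dm; move: mN; rewrite (disj Dm Dk) ltnNge Nk.
have /cvgrPdist_lt /(_ _ e3) := @cont_xin N p ps.
apply: (@filterS _ (nbhs p)) => q h qs; have := h qs; have := close p; have := close q.
have := ler_distD (xin N p) (xi p) (xi q).
have := ler_distD (xin N q) (xin N p) (xi q).
by rewrite [`|xin N q - xi q|]distrC => *; lra.
Qed.

(** On a hutch, [e k] is injective on the open square and sends its points outside [bdsq] and [X k],
    where the points of [bdsq] go. Only points of [bdsq] in a hutch can thus be identified, and they
    lie on the top or bottom side. A map fixing these sides pointwise still descends through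
    [xi]. *)
Lemma xi_inj p q : sq p -> sq q -> xi p = xi q -> p = q \/ (`|p.2| = 1 /\ `|q.2| = 1).
Proof.
wlog: p q / (exists k, D k p) \/ (forall k, ~ D k q).
  move=> h ps qs pq; have [hp|hp] := in_or_out p; first by apply: h => //; left.
  have [[k hq]|hq] := in_or_out q; last by apply: h => //; right.
  by have [->|[? ?]] := h q p (or_introl (ex_intro _ k hq)) qs ps (esym pq); [left|right].
move=> [[k Dp]|nDq] ps qs.
  have [[m Dq]|nDq] := in_or_out q; last first.
    rewrite (xi_in Dp) (xi_out nDq) => pq; exfalso; apply: (nDq k).
    by rewrite -pq; exact: opening_in (op k) _ Dp.
  rewrite (xi_in Dp) (xi_in Dq) => pq.
  have km : k = m.
    apply: (@disj _ _ (e k p)); first exact: opening_in (op k) _ Dp.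
    by rewrite pq; exact: opening_in (op m) _ Dq.
  subst m; have cross u v : osq u -> bdsq v -> e k u <> e k v.
    move=> /(opening_osq (op k)) [uo uX] /(opening_bd (op k)) [[_ vo]|vX] uv.
      by apply: vo; rewrite -uv.
    by apply: uX; rewrite uv.
  have [po|po] := pselect (osq p); have [qo|qo] := pselect (osq q).
  - by left; exact: (opening_inj (op k)).
  - by exfalso; apply: (cross p q).
  - by exfalso; apply: (cross q p).
  - have [_ p2] := opening_trace (op k) (conj Dp (conj ps po)).
    have [_ q2] := opening_trace (op k) (conj Dq (conj qs qo)).
    by right; rewrite p2 q2.
have [[k Dp]|nDp] := in_or_out p; last by rewrite !xi_out//; left.
rewrite (xi_in Dp) (xi_out nDq) => pq; exfalso; apply: (nDq k).
by rewrite -pq; exact: opening_in (op k) _ Dp.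
Qed.

Lemma e_preimage k p q : e k p = q -> D k q -> D k p.
Proof.
by move=> pq Dq; apply: contrapT => nDp; apply: (nDp); rewrite -(opening_out (op k) nDp) pq.
Qed.

Lemma xi_surj q : sq q -> exists2 p, sq p & xi p = q.
Proof.
move=> qs; have [[k Dq]|nD] := in_or_out q; last by exists q => //; exact: xi_out.
have [p ps pq] := opening_surj (op k) qs; exists p => //.
by rewrite (xi_in (e_preimage pq Dq)).
Qed.

Lemma xi_osq_surj q : osq q -> (forall k, ~ X k q) -> exists2 p, osq p & xi p = q.
Proof.
move=> qs qX; have [[k Dq]|nD] := in_or_out q; last by exists q => //; exact: xi_out.
have [p ps pq] := opening_osq_surj (op k) qs (qX k); exists p => //.
by rewrite (xi_in (e_preimage pq Dq)).
Qed.

Lemma xi_hseg k : xi @` hseg (al k) (be k) (s k) = Z k.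
Proof.
rewrite -(opening_img (op k)); apply/seteqP; split => _ [p pS <-]; exists p => //.
  by rewrite (xi_in (opening_seg (op k) pS)).
by rewrite (xi_in (opening_seg (op k) pS)).
Qed.

End Xi.

(** A continuous map from a compact set to a Hausdorff space is closed, hence a quotient map onto
    its image. *)
Lemma cont_on_quotient (T U W : topologicalType) (K : set T) (f : T -> U) (g : U -> W) :
  hausdorff_space U -> closed K -> compact K -> cont_on K f -> cont_on K (g \o f) ->
  cont_on (f @` K) g.
Proof.
move=> hU clK cK cf cgf y fKy A Ay.
have cC : closed (~` A°) by apply: open_closedC; exact: open_interior.
have cKC := compact_cont_on clK cK cgf cC.
have clf : closed (f @` (K `&` (g \o f) @^-1` (~` A°))).
  apply: compact_closed => //; apply: continuous_compact => //.
  by apply/cont_onP; apply: cont_onS cf => x [].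
have : nbhs y (~` (f @` (K `&` (g \o f) @^-1` (~` A°)))).
  apply: open_nbhs_nbhs; split; first exact: closed_openC.
  by move=> [x [_ /= h] xy]; apply: h; rewrite xy; exact: Ay.
apply: (@filterS _ (nbhs y)) => y' hy' [x Kx xy'] /=; apply: contrapT => nA.
apply: hy'; exists x => //; split => //= /interior_subset.
by rewrite xy'.
Qed.

(** One inclusion is continuity of [f]. For the other, let [y] be outside the image of [B]: each
    point of [K] has a neighbourhood that the orbit of [p] finally leaves or that [f] keeps away
    from [y], and finitely many of these cover [K]. *)
Lemma omega_lim_image (R : realType) (K : set (R * R)) (f g h : R * R -> R * R) (p : R * R)
    (B : set (R * R)) :
  compact K -> cont_on K f -> (forall q, K q -> K (g q)) ->
  (forall q, K q -> h (f q) = f (g q)) -> K p -> B `<=` K ->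
  omega_lim g p = B -> omega_lim h (f p) = f @` B.
Proof.
move=> cK cf gK hf Kp BK gB.
have Kn n : K (iter n g p) by elim: n => //= n IH; exact: gK.
have hn n : iter n h (f p) = f (iter n g p) by elim: n => //= n ->; rewrite hf.
apply/seteqP; split => [y yo|_ [b Bb <-] U Ub N]; last first.
  have bo : omega_lim g p b by rewrite gB.
  have [n [nN nU]] := bo _ (cf b (BK _ Bb) _ Ub) N.
  by exists n; split => //; rewrite hn; apply: nU.
apply: contrapT => nB.
pose Q (z : (R * R) * nat) (b : R * R) := K b -> iter z.2 g p = b -> f b <> z.1.
have : \forall z \near filter_prod (nbhs y) \oo, K `<=` Q z.
  apply: (iffLR (compact_near_coveringP _) cK) => b Kb.
  have [bo|nbo] := pselect (omega_lim g p b).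
    have fby : f b <> y by move=> e; apply: nB; exists b => //; rewrite -gB.
    pose r := `|f b - y| / 2.
    have r0 : 0 < r by rewrite divr_gt0// normr_gt0 subr_eq0; exact/eqP.
    have /= nb := cf b Kb _ (nbhsx_ballx (f b) r r0).
    exists ([set b' | K b' -> ball (f b) r (f b')], ball y r `*` setT) => /=.
      split => //; exists (ball y r, setT) => //=; split; last exact: filterT.
      exact: nbhsx_ballx.
    move=> [b' [y' n]] /= [b'r [y'r _]] Kb' _ e.
    have := b'r Kb'; move: y'r; rewrite -!ball_normE /= e /= => h1 h2.
    have := ler_distD y' (f b) y; rewrite [`|y' - y|]distrC.
    by move: h1 h2; rewrite /r; clear; lra.
  have [V [bV [N VN]]] : exists V, nbhs b V /\ exists N, forall n, (N <= n)%N -> ~ V (iter n g p).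
    apply: contrapT => noV; apply: nbo => V bV N; apply: contrapT => non; apply: noV.
    by exists V; split => //; exists N => n nN nV; apply: non; exists n.
  exists (V, setT `*` [set n | (N <= n)%N]) => /=.
    split => //; exists (setT, [set n | (N <= n)%N]) => //=; split; first exact: filterT.
    by exists N.
  by move=> [b' [y' n]] /= [Vb' [_ nN]] _ e; exfalso; apply: (VN n nN); rewrite e.
move=> [[U M] [/= yU [N _ NM]] UM].
have [n [nN nU]] := yo U yU N.
have UMn : (U `*` M) (iter n h (f p), n) by split => //=; exact: NM.
by apply: (UM _ UMn (iter n g p)) => //=; rewrite hn.
Qed.

(** * Small hutches, and conjugation through the quotient *)

Section Assembly.
Context {R : realType}.
Local Notation P := (R * R)%type.

Lemma norm_le_dist (p q : P) : `|p - q| <= dist p q.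
Proof.
rewrite prod_normE ge_max /dist/= -!sqrtr_sqr !ler_wsqrtr//.
  by rewrite lerDr sqr_ge0.
by rewrite lerDl sqr_ge0.
Qed.

Lemma norm_le_diam (D : set P) (p q : P) : D `<=` @sq R -> D p -> D q -> `|p - q| <= diam D.
Proof.
move=> Ds Dp Dq; apply: (le_trans (norm_le_dist p q)).
apply: ub_le_sup; last by exists p, q.
(* A crude bound for the diagonal of the square; the distances must be bounded for their [sup] to
   dominate them. *)
exists 3 => _ [u [v [Du [Dv ->]]]].
rewrite -[leRHS]ger0_norm// -sqrtr_sqr ler_wsqrtr//.
have [/andP[a1 a2] /andP[a3 a4]] := Ds _ Du; have [/andP[b1 b2] /andP[b3 b4]] := Ds _ Dv.
have key (x y : R) : -1 <= x -> x <= 1 -> -1 <= y -> y <= 1 -> (x - y) ^+ 2 <= 4.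
  move=> x1 x2 y1 y2; rewrite (_ : 4 = 2 ^+ 2); last by ring.
  by rewrite -real_normK ?num_real// ler_pXn2r ?nnegrE// ler_norml; apply/andP; split; lra.
have := key _ _ a1 a2 b1 b2; have := key _ _ a3 a4 b3 b4; clear; lra.
Qed.

Lemma diam_cvg_small (D : nat -> set P) : (forall n, D n `<=` @sq R) ->
  (fun n => diam (D n)) @ \oo --> (0 : R) -> forall e : R, 0 < e ->
  exists N, forall n, (N <= n)%N -> forall p q, D n p -> D n q -> `|p - q| < e.
Proof.
move=> Ds /cvgrPdist_lt h e /h [N _ HN]; exists N => n Nn p q Dp Dq.
apply: le_lt_trans (norm_le_diam (Ds n) Dp Dq) _.
by have := HN n Nn; rewrite sub0r normrN; apply: le_lt_trans; exact: ler_norm.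
Qed.

(** Points identified by [xi] lie on sides fixed by both [Phi] and [Psi], so the conjugates do not
    depend on the preimage chosen by [inv]. Their continuity comes from [cont_on_quotient]. *)
Lemma conjugate_homeo (xi Phi Psi : P -> P) :
  cont_on (@sq R) xi -> (forall p, sq p -> sq (xi p)) ->
  (forall q, sq q -> exists2 p, sq p & xi p = q) ->
  (forall p q, sq p -> sq q -> xi p = xi q -> p = q \/ (`|p.2| = 1 /\ `|q.2| = 1)) ->
  homeo_pair (@sq R) (@sq R) Phi Psi ->
  (forall p, sq p -> `|p.2| = 1 -> Phi p = p) ->
  exists psi psiinv : P -> P, homeo_pair (@sq R) (@sq R) psi psiinv /\
    (forall p, sq p -> psi (xi p) = xi (Phi p)) /\
    (forall p, sq p -> psiinv (xi p) = xi (Psi p)).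
Proof.
move=> cxi xs xsurj xinj [/cont_onP cPhi [/cont_onP cPsi [Phis [Psis [PK KP]]]]] Phi1.
have Psi1 p : sq p -> `|p.2| = 1 -> Psi p = p by move=> ps p1; rewrite -{1}(Phi1 p)// PK.
pose inv y := xget (0 : P) [set p | sq p /\ xi p = y].
have invP y : sq y -> sq (inv y) /\ xi (inv y) = y.
  move=> ys; have [p ps py] := xsurj y ys.
  exact: (xgetPex 0 (ex_intro _ p (conj ps py)) : [set p | sq p /\ xi p = y] (inv y)).
have conj (F : P -> P) : (forall p, sq p -> `|p.2| = 1 -> F p = p) ->
    forall p, sq p -> xi (F (inv (xi p))) = xi (F p).
  move=> F1 p ps; have [is_ ie] := invP _ (xs p ps).
  by have [->//|[i1 p1]] := xinj _ _ is_ ps ie; rewrite !F1.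
have cont (F : P -> P) : cont_on (@sq R) F -> (forall p, sq p -> sq (F p)) ->
    (forall p, sq p -> `|p.2| = 1 -> F p = p) -> cont_on (@sq R) (fun y => xi (F (inv y))).
  move=> cF Fs F1; have -> : @sq R = xi @` @sq R.
    by apply/seteqP; split => [y /xsurj[p ps <-]|_ [p ps <-]]; [exists p|exact: xs].
  have csq := @sq_compact R.
  have clsq : closed (@sq R) by apply: compact_closed => //; exact: norm_hausdorff.
  apply: (@cont_on_quotient _ _ _ _ xi _ (@norm_hausdorff _ P)) => //.
  apply: (@cont_on_eq _ _ _ (xi \o F)); first by move=> p ps /=; rewrite conj.
  exact: cont_on_comp cxi Fs.
exists (fun y => xi (Phi (inv y))), (fun y => xi (Psi (inv y))); split; last first.
  by split; exact: conj.
split; [exact/cont_onP/cont|split; [exact/cont_onP/cont|]].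
split; first by move=> y /invP[i1 _]; apply/xs/Phis.
split; first by move=> y /invP[i1 _]; apply/xs/Psis.
split=> y ys; have [i1 i2] := invP y ys.
  by rewrite conj ?PK//; exact: Phis.
by rewrite conj ?KP//; exact: Psis.
Qed.

End Assembly.

(** * The homeomorphism with the prescribed omega- and alpha-limit sets *)

Theorem theorem4p7 (R : realType)
  (X1 X2 D1 D2 Y1 Y2 L1 L2 W : nat -> set (pt R)) (N' N'' : set nat) :
  (forall n, hanging 1 (X1 n) /\ hutch 1 (X1 n) (D1 n) /\ permeable 1 (X1 n) (D1 n)) ->
  (forall n, hanging (-1) (X2 n) /\ hutch (-1) (X2 n) (D2 n) /\
             permeable (-1) (X2 n) (D2 n)) ->
  (fun n => diam (D1 n)) @ \oo --> (0 : R) ->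
  (fun n => diam (D2 n)) @ \oo --> (0 : R) ->
  (forall n m, n <> m -> D1 n `&` D1 m = set0) ->
  (forall n m, n <> m -> D2 n `&` D2 m = set0) ->
  (forall n m, D1 n `&` D2 m = set0) ->
  (forall n, N' n -> floating (Y1 n) /\ cable 1 (Y1 n) (L1 n) /\
                     X1 n = Y1 n `|` L1 n) ->
  (forall n, N'' n -> floating (Y2 n) /\ cable (-1) (Y2 n) (L2 n) /\
                      X2 n = Y2 n `|` L2 n) ->
  (forall n m, n <> m -> W n `&` W m = set0) ->
  (forall n, countable (W n)) ->
  (forall n, W n `<=` @osq R `\` \bigcup_k (X1 k `|` X2 k)) ->
  (forall n, @sq R `<=` closure (W n)) ->
  exists psi psiinv : pt R -> pt R,
    homeo_pair (@sq R) (@sq R) psi psiinv /\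
    forall n w, W n w ->
      (~ N' n -> omega_lim psi w = X1 n) /\
      (N' n -> omega_lim psi w = Y1 n) /\
      (~ N'' n -> omega_lim psiinv w = X2 n) /\
      (N'' n -> omega_lim psiinv w = Y2 n).
Proof.
move=> H1 H2 d1 d2 D11 D22 D12 F1 F2 WW cW Wo _.
pose P := (R * R)%type.
(* The two families are interleaved: index [n.*2] is hutch [n] of the top side, index [n.*2.+1]
   hutch [n] of the bottom side. *)
pose s k : R := if odd k then -1 else 1.
pose pick T (A B : nat -> T) k := if odd k then B k./2 else A k./2.
pose D := pick _ D1 D2; pose X := pick _ X1 X2.
pose Z1 n := if `[< N' n >] then Y1 n else X1 n.
pose Z2 n := if `[< N'' n >] then Y2 n else X2 n.
pose Z := pick _ Z1 Z2.
have s1 k : `|s k| = 1 by rewrite /s; case: ifP; rewrite ?normrN1 ?normr1.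
have ex_op k : exists e : (P -> P) * (R * R), opening (s k) (X k) (D k) (Z k) e.1 e.2.1 e.2.2.
  have [e [al [be h]]] : exists e al be, opening (s k) (X k) (D k) (Z k) e al be.
    have [hX [hD hP]] : hanging (s k) (X k) /\ hutch (s k) (X k) (D k) /\ permeable (s k) (X k) (D k).
      by rewrite /s /X /D /pick; case: ifP => _; [exact: H2|exact: H1].
    apply: exists_opening => //.
    rewrite /Z /X /s /pick; case: ifP => _; [rewrite /Z2|rewrite /Z1]; case: ifPn => h;
      try by left.
      right; have [a [b c]] := F2 _ (asboolW h); by exists (L2 k./2).
    right; have [a [b c]] := F1 _ (asboolW h); by exists (L1 k./2).
  by exists (e, (al, be)).
have [E op] := choice ex_op.
pose e k := (E k).1; pose al k := (E k).2.1; pose be k := (E k).2.2.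
have disj k m p : D k p -> D m p -> k = m.
  rewrite /D /pick => Dk Dm.
  rewrite -[k]odd_double_half -[m]odd_double_half.
  case: ifP Dk Dm => ok; case: ifP => om Dk Dm; rewrite ?ok ?om.
  - have [kk|/eqP km] := eqVneq k./2 m./2; first by rewrite kk.
    by have : set0 p by rewrite -(D22 _ _ km).
  - by have : set0 p by rewrite -(D12 m./2 k./2).
  - by have : set0 p by rewrite -(D12 k./2 m./2).
  - have [kk|/eqP km] := eqVneq k./2 m./2; first by rewrite kk.
    by have : set0 p by rewrite -(D11 _ _ km).
have small (ep : R) : 0 < ep -> exists N, forall k, (N <= k)%N ->
    forall p q, D k p -> D k q -> `|p - q| < ep.
  move=> ep0.
  have s1' n : D1 n `<=` @sq R by have [_ [[_ []]]] := H1 n.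
  have s2' n : D2 n `<=` @sq R by have [_ [[_ []]]] := H2 n.
  have [M1 HM1] := diam_cvg_small s1' d1 ep0; have [M2 HM2] := diam_cvg_small s2' d2 ep0.
  exists (maxn M1 M2).*2 => k Nk p q.
  have : (maxn M1 M2 <= k./2)%N by rewrite -[maxn _ _]doubleK half_leq.
  rewrite geq_max => /andP[k1 k2]; rewrite /D /pick; case: ifP => _; [exact: HM2|exact: HM1].
pose x := xi D e.
have xinj p q : osq p -> osq q -> x p = x q -> p = q.
  move=> po qo pq.
  have [//|[p2 _]] := xi_inj s1 op disj (osq_sq po) (osq_sq qo) pq.
  by move: po; rewrite osqE /= prod_normE p2 gt_max ltxx andbF.
(* The points to be steered: preimages in the open square of the points of all [W n], countable
   because [x] is injective there. *)
pose V : set P := [set v | osq v /\ exists n, W n (x v)].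
have cV : countable V.
  have cWW : countable (\bigcup_n W n) by apply: bigcup_countable => // n _; exact: cW.
  have /countable_injP [j jinj] := cWW.
  apply/countable_injP; exists (j \o x) => v v' /set_mem [vo [n vW]] /set_mem [vo' [n' vW']] /= jj.
  by apply: xinj => //; apply: jinj => //; apply/mem_set; [exists n|exists n'].
(* The sets [W n] are disjoint, so the index is unique; the default 0 does not occur on [V]. *)
pose nv v := xget 0%N [set n | W n (x v)].
have nvE n v : W n (x v) -> nv v = n.
  move=> Wn; apply: xget_unique => // m Wm; apply: contrapT => mn.
  have : set0 (x v) by rewrite -(WW _ _ mn).
  by [].
have [Phi [Psi [hPhi [Phi1 lim]]]] := @homeo_prescribed_limits R V
  (fun v => al (nv v).*2) (fun v => be (nv v).*2)
  (fun v => al (nv v).*2.+1) (fun v => be (nv v).*2.+1) cV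
  (fun v vV => vV.1)
  (fun v _ => conj (opening_al (op _)) (conj (opening_albe (op _)) (opening_be (op _))))
  (fun v _ => conj (opening_al (op _)) (conj (opening_albe (op _)) (opening_be (op _)))).
have [psi [psiinv [hpsi [cpsi cpsiinv]]]] := conjugate_homeo
  (cont_xi op disj small) (xi_sq op disj) (xi_surj op disj) (xi_inj s1 op disj) hPhi Phi1.
exists psi, psiinv; split => // n w Ww.
have [wo wX] := Wo n w Ww.
have [v vo vw] : exists2 v, osq v & x v = w.
  apply: (xi_osq_surj op disj) => // k; rewrite /X /pick; case: ifP => _ Xw.
    by apply: wX; exists k./2 => //; right.
  by apply: wX; exists k./2 => //; left.
have vV : V v by split => //; exists n; rewrite vw.
have nvn : nv v = n by apply: nvE; rewrite vw.
have [l1 l2] := lim v vV; rewrite nvn in l1 l2.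
have csq := @sq_compact R.
have [_ [_ [Phis [Psis _]]]] := hPhi.
have segsq k : hseg (al k) (be k) (s k) `<=` @sq R.
  by move=> p /(opening_seg (op k)); exact: opening_dsq (op k) _.
have so : s n.*2.+1 = -1 by rewrite /s /= odd_double.
have se : s n.*2 = 1 by rewrite /s /= odd_double.
have w1 : omega_lim psi w = Z1 n.
  rewrite -vw (omega_lim_image csq (cont_xi op disj small) Phis cpsi (osq_sq vo) _ l1); last first.
    by rewrite -se; exact: segsq.
  by rewrite -se (xi_hseg op disj) /Z /pick odd_double doubleK.
have w2 : omega_lim psiinv w = Z2 n.
  rewrite -vw (omega_lim_image csq (cont_xi op disj small) Psis cpsiinv (osq_sq vo) _ l2); last first.
    by rewrite -so; exact: segsq.
  by rewrite -so (xi_hseg op disj) /Z /pick /= odd_double /= uphalf_double.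
rewrite w1 w2 /Z1 /Z2; split; first by move=> h; rewrite asboolF.
split; first by move=> h; rewrite asboolT.
split; first by move=> h; rewrite asboolF.
by move=> h; rewrite asboolT.
Qed.
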